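(* Let $I\subset\mathbb R$ be an interval, let $h\in C^\infty(I)$, and for $u\neq v$ in $I$ let $\Psi(u,v)$ be the intersection point of the lines $L_u$ and $L_v$, where $L_t:\ y=tx+h(t)$. Let $\widetilde I\subset\mathbb R$ be an interval and let $\varphi:\widetilde I\to I$ be a (smooth) local diffeomorphism. For $r\neq s$ in $\widetilde I$ set $$\widetilde\Psi(r,s):=\Psi\bigl(\varphi(r),\varphi(s)\bigr),\qquad \widetilde S_h(r,s):=\partial_r\partial_s\log\bigl|J_{\widetilde\Psi}(r,s)\bigr|,$$ where $J_{\widetilde\Psi}$ is the Jacobian determinant of $\widetilde\Psi$. Let $s_0\in\widetilde I$ satisfy $h''(\varphi(s_0))\neq0$. Then, for $r\neq s$ with $(r,s)$ near $(s_0,s_0)$, $$\widetilde S_h(r,s)=\frac{1}{(s-r)^2}+\widetilde R_h(r,s),$$ where $\widetilde R_h$ extends smoothly across the diagonal near $(s_0,s_0)$. Its diagonal value satisfies, for $s$ near $s_0$, $$\widetilde R_h(s,s)=R_h\bigl(\varphi(s),\varphi(s)\bigr)\,\varphi'(s)^2+\frac16\{\varphi,s\},$$ where $R_h$ is the smooth extension across the diagonal, near $(\varphi(s_0),\varphi(s_0))$, of $\partial_u\partial_v\log|J_\Psi(u,v)|-\frac1{(v-u)^2}$, and $\{\varphi,s\}$ is the Schwarzian derivative of $\varphi$ with respect to $s$.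
   Context: For $u\neq v$ in $I$, the intersection point of $L_u$ and $L_v$ is $$\Psi(u,v)=(x(u,v),y(u,v))=\left(\frac{h(v)-h(u)}{u-v},\ \frac{u\,h(v)-v\,h(u)}{u-v}\right),$$ and $J_\Psi=x_uy_v-x_vy_u$. Near a diagonal point $(t_0,t_0)$ with $h''(t_0)\neq0$, the function $S_h(u,v)=\partial_u\partial_v\log|J_\Psi(u,v)|$ is defined off the diagonal, and $S_h(u,v)-1/(v-u)^2$ extends to a smooth function $R_h$ on a full neighborhood of $(t_0,t_0)$ in $I\times I$, including the diagonal; here this is used with $t_0=\varphi(s_0)$. The asserted identity for $\widetilde S_h$ includes the assertion that it is defined at off-diagonal points near $(s_0,s_0)$. Schwarzian derivative: for a local diffeomorphism $f=f(t)$ of the line, $\{f,t\}=\left(\frac{f''}{f'}\right)'-\frac12\left(\frac{f''}{f'}\right)^2=\frac{f'''}{f'}-\frac32\left(\frac{f''}{f'}\right)^2$. *)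

(* Defs.v *)
From mathcomp Require Import all_boot all_order all_algebra.
From mathcomp Require Import all_classical all_reals all_analysis.
From mathcomp Require Import ring lra.

Set Implicit Arguments.
Unset Strict Implicit.
Unset Printing Implicit Defensive.

Import Order.TTheory GRing.Theory Num.Theory.
Import numFieldNormedType.Exports.

Local Open Scope classical_set_scope.
Local Open Scope ring_scope.

Definition nondegenerate_interval (R : realType) (A : set R) : Prop :=
  is_interval A /\ exists x y, [/\ A x, A y & x < y].

(* In finite dimension this is the usual class C^k: all directional derivatives
   of order at most [k] exist on [U] and are continuous there.  It is only used
   with [U] open. *)
Fixpoint Ck (R : realType) (V : normedModType R) (k : nat) (U : set V)
    (f : V -> R) : Prop :=
  {in U, continuous f} /\
  if k is k'.+1 then
    forall v : V, (forall x, U x -> derivable f x v) /\ Ck k' U ('D_v f)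
  else True.

(* On a set that need not be open (an interval may contain its end points),
   smooth means: locally the restriction of a smooth function defined on an
   open set.  Only the values of [f] on [A] matter. *)
Definition smooth_on (R : realType) (V : normedModType R) (A : set V)
    (f : V -> R) : Prop :=
  forall a, A a -> exists (U : set V) (F : V -> R),
    [/\ open U, U a, forall k, Ck k U F & {in A `&` U, f =1 F}].

(* [phi] restricts near each point of [J] to a diffeomorphism onto its image.
   If [J] and the target interval are open, these images are automatically
   open; not requiring it also admits, e.g., [0, 1] inside the real line. *)
Definition local_diffeo (R : realType) (J : set R) (phi : R -> R) : Prop :=
  forall s, J s -> exists (U : set R) (psi : R -> R),
    [/\ open U, U s, smooth_on (J `&` U) phi,
        smooth_on (phi @` (J `&` U)) psi & {in J `&` U, cancel phi psi}].

(* The limit of the difference quotient along [A]: the usual derivative at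
   interior points of [A], the one-sided one at an end point. *)
Definition derivable_within (R : realType) (A : set R) (f : R -> R) (x : R) :
    Prop :=
  cvg ((f y - f x) / (y - x) @[y --> within A x^']).

Definition derive_within (R : realType) (A : set R) (f : R -> R) (x : R) : R :=
  lim ((f y - f x) / (y - x) @[y --> within A x^']).

Definition schwarzian (R : realType) (A : set R) (f : R -> R) : R -> R :=
  let f1 := derive_within A f in
  let q t := derive_within A f1 t / f1 t in
  fun t => derive_within A q t - 2^-1 * q t ^+ 2.

Section TwoVariables.
Variables (R : realType) (A : set R).
Implicit Types (f : R * R -> R) (F : R * R -> R * R) (p : R * R).

Definition partial1 f p : R := derive_within A (fun u => f (u, p.2)) p.1.
Definition partial2 f p : R := derive_within A (fun v => f (p.1, v)) p.2.

Definition has_partial1 f p : Prop :=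
  derivable_within A (fun u => f (u, p.2)) p.1.
Definition has_partial2 f p : Prop :=
  derivable_within A (fun v => f (p.1, v)) p.2.

Definition jacobian F p : R :=
  partial1 (fst \o F) p * partial2 (snd \o F) p -
  partial2 (fst \o F) p * partial1 (snd \o F) p.

Definition has_jacobian F p : Prop :=
  [/\ has_partial1 (fst \o F) p, has_partial2 (fst \o F) p,
      has_partial1 (snd \o F) p & has_partial2 (snd \o F) p].

Definition log_jacobian F p : R := ln `|jacobian F p|.

Definition mixed_log_jacobian F p : R :=
  partial1 (partial2 (log_jacobian F)) p.

(* All quantities in [mixed_log_jacobian F p] are given by genuine limits, and
   the logarithm is taken of positive numbers. *)
Definition mixed_log_jacobian_defined F p : Prop :=
  (\forall q \near within (A `*` A) (nbhs p),
     [/\ has_jacobian F q, jacobian F q != 0 &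
         has_partial2 (log_jacobian F) q]) /\
  has_partial1 (partial2 (log_jacobian F)) p.

(* [Q] extends [mixed_log_jacobian F (u, v) - 1 / (v - u)^2] smoothly across
   the diagonal, on a full relative neighborhood of [(t, t)] in [A x A]. *)
Definition diagonal_remainder F (t : R) (Q : R * R -> R) : Prop :=
  exists U : set (R * R),
    [/\ open U, U (t, t), smooth_on ((A `*` A) `&` U) Q &
        forall u v, A u -> A v -> U (u, v) -> u != v ->
          mixed_log_jacobian_defined F (u, v) /\
          mixed_log_jacobian F (u, v) = 1 / (v - u) ^+ 2 + Q (u, v)].

End TwoVariables.

Definition line (R : realType) (h : R -> R) (t : R) : set (R * R) :=
  [set p | p.2 = t * p.1 + h t].

Definition Psi (R : realType) (h : R -> R) (p : R * R) : R * R :=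
  let: (u, v) := p in
  ((h v - h u) / (u - v), (u * h v - v * h u) / (u - v)).

Lemma line_meet (R : realType) (h : R -> R) (u v : R) :
  u != v -> line h u `&` line h v = [set Psi h (u, v)].
Proof.
move=> uv; have d0 : u - v != 0 by rewrite subr_eq0.
apply/seteqP; split => [[x y]|_ ->]; rewrite /line /=; last by split; field.
move=> [-> E]; have -> : x = (h v - h u) / (u - v).
  by apply: (mulIf d0); rewrite divfK //; lra.
by congr pair; field.
Qed.

(* Main.v *)
Require Import Defs.
From mathcomp Require Import all_boot all_order all_algebra.
From mathcomp Require Import all_classical all_reals all_analysis.
From mathcomp Require Import ring lra.

Set Implicit Arguments.
Unset Strict Implicit.
Unset Printing Implicit Defensive.

Import Order.TTheory GRing.Theory Num.Theory.
Import numFieldNormedType.Exports.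

Local Open Scope classical_set_scope.
Local Open Scope ring_scope.

(** Both Jacobians have a simple zero along the diagonal, and everything follows
    from factoring it out. Write [D u v = h v - h u - h' u * (v - u)]. The
    Jacobian of [Psi] is [D u v * D v u / (u - v) ^ 3]. By Taylor's formula
    [D u v = (v - u) ^ 2 * M u v] with [M] smooth across the diagonal and equal to
    [h'' / 2] there, so the Jacobian is [(u - v) * K u v] with
    [K u v = M u v * M v u] smooth and nonzero near a diagonal point at which
    [h''] does not vanish. In [ln `|J| = ln `|u - v| + ln `|K|] the first term has
    mixed derivative [1 / (v - u) ^ 2], and that of the second term is the smooth
    remainder ([diagonal_remainder_factor]).

    For the reparametrized map the Jacobian is
    [(r - s) * (K (phi r) (phi s) * Q r s * phi' r * phi' s)] where [Q] is the
    difference quotient of [phi] ([jacobian_Psi]), so the same argument applies.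
    The mixed logarithmic derivative is additive over the factors
    ([mixlog_mul]): the first one gives the old remainder times
    [phi' r * phi' s] ([mixlog_prod_map]), the last two give nothing, and [Q]
    gives a sixth of the Schwarzian derivative on the diagonal
    ([mixlog_tquot1_diag]). An arbitrary pair of remainders is compared with
    these by continuity ([diagonal_remainder_unique]).

    Smoothness of [M] and [Q] is proved for all quotients
    [tquot n f (u, v)] of the [n]-th Taylor remainder of [f] by [(v - u) ^ n] at
    once, because their partial derivatives are combinations of such quotients
    ([tquot_diff]). The functions [h] and [phi] live on intervals that may contain
    end points; they are replaced by smooth extensions [f] and [P] to open sets,
    and only then are partial derivatives taken ([is_derive_within]). *)

(** * Functions differentiable to a given order *)

(** An epsilon estimate is easier to produce, and to transport along an equality
    near a point, than an equation between little-o terms. *)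
Lemma differentiable_eps (R : realType) (V : normedModType R) (f : V -> R)
    (df : {linear V -> R}) x :
  continuous df ->
  (forall e : R, 0 < e ->
    \forall h \near (0 : V), `|f (h + x) - f x - df h| <= e * `|h|) ->
  differentiable f x /\ 'd f x = df :> (V -> R).
Proof.
move=> cdf H.
have E : f \o shift x = cst (f x) + df +o_ 0 id.
  apply/eqaddoP => e e0; have {H} := H e e0.
  by apply: filterS => h /=; rewrite /cst fctE /= opprD addrA.
by have dE := diff_unique cdf E; split=> //; apply/diff_locallyP; rewrite dE.
Qed.

Lemma near_eq_differentiable (R : realType) (V : normedModType R)
    (f g : V -> R) x :
  (\near x, f x = g x) -> differentiable f x -> differentiable g x.
Proof.
move=> fg df; apply: (@differentiable_eps _ _ _ ('d f x) x _ _).1.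
  exact: diff_continuous.
move=> e e0; have [_ /eqaddoP/(_ e e0) H] := (diff_locallyP _ _).1 df.
have gx := nbhs_singleton fg.
have fg' : \forall h \near (0 : V), f (h + x) = g (h + x).
  rewrite (near_shift x (0 : V)) /=.
  by apply: filterS fg => y; rewrite /= sub0r subrK.
apply: filterS2 H fg' => h /= + E.
by rewrite !fctE /cst /= opprD addrA E gx.
Qed.

(** Differentiability of order [k] in the Frechet sense. It implies [Ck]; unlike
    [Ck], it passes through the chain rule without first proving that
    continuous partial derivatives make a function differentiable. *)
Fixpoint Dk (R : realType) (V : normedModType R) (k : nat) (U : set V)
    (f : V -> R) : Prop :=
  (forall x, U x -> differentiable f x) /\
  if k is k'.+1 then forall v : V, Dk k' U ('D_v f) else True.

Lemma Dk_diff (R : realType) (V : normedModType R) k (U : set V) f x :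
  Dk k U f -> U x -> differentiable f x.
Proof. by case: k => [|k] [+ _]; apply. Qed.

Lemma Dk_le (R : realType) (V : normedModType R) k (U : set V) f :
  Dk k.+1 U f -> Dk k U f.
Proof.
elim: k f => [|k IH] f [df Df]; split=> // v.
exact: IH.
Qed.

Lemma Dk_sub (R : realType) (V : normedModType R) k (U U' : set V) f :
  U' `<=` U -> Dk k U f -> Dk k U' f.
Proof.
move=> sU; elim: k f => [|k IH] f [df Df]; split; try by move=> x /sU /df.
  by [].
by move=> v; exact: IH (Df v).
Qed.

Lemma Dk_Ck (R : realType) (V : normedModType R) k (U : set V) f :
  Dk k U f -> Ck k U f.
Proof.
elim: k f => [|k IH] f [df Df]; split=> //.
- by move=> x /set_mem Ux; exact/differentiable_continuous/df.
- by move=> x /set_mem Ux; exact/differentiable_continuous/df.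
- by move=> v; split=> [x Ux|]; [exact/diff_derivable/df | exact: IH (Df v)].
Qed.

Lemma near_of_open (T : topologicalType) (U : set T) (P : T -> Prop) x :
  open U -> (forall y, U y -> P y) -> U x -> \forall y \near x, P y.
Proof.
by move=> oU UP Ux; apply: (@filterS _ (nbhs x) _ U) => //; exact: open_nbhs_nbhs.
Qed.

Lemma Dk_eq (R : realType) (V : normedModType R) k (U : set V) f g :
  open U -> (forall x, U x -> f x = g x) -> Dk k U f -> Dk k U g.
Proof.
move=> oU; elim: k f g => [|k IH] f g fg [df Df]; split=> //.
- move=> x Ux; apply: near_eq_differentiable (df x Ux).
  exact: (near_of_open oU fg).
- move=> x Ux; apply: near_eq_differentiable (df x Ux).
  exact: (near_of_open oU fg).
- move=> v; apply: IH (Df v) => x Ux; apply: near_eq_derive.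
  exact: (near_of_open oU fg).
Qed.

Lemma Dk_cst (R : realType) (V : normedModType R) k (U : set V) (c : R) :
  Dk k U (fun _ => c).
Proof.
elim: k c => [|k IH] c; split=> //; try by move=> x _; exact: differentiable_cst.
move=> v; rewrite (_ : 'D_v _ = fun=> 0) //.
by apply/funext => x; exact: derive_cst.
Qed.

Lemma DkD (R : realType) (V : normedModType R) k (U : set V) f g :
  open U -> Dk k U f -> Dk k U g -> Dk k U (fun x => f x + g x).
Proof.
move=> oU; elim: k f g => [|k IH] f g [df Df] [dg Dg]; split=> //.
- by move=> x Ux; apply: (differentiableD (df _ Ux) (dg _ Ux)).
- by move=> x Ux; apply: (differentiableD (df _ Ux) (dg _ Ux)).
- move=> v; apply: (Dk_eq oU _ (IH _ _ (Df v) (Dg v))) => x Ux.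
  have hf := diff_derivable (v := v) (df _ Ux).
  have hg := diff_derivable (v := v) (dg _ Ux).
  exact: esym (deriveD hf hg).
Qed.

Lemma DkM (R : realType) (V : normedModType R) k (U : set V) f g :
  open U -> Dk k U f -> Dk k U g -> Dk k U (fun x => f x * g x).
Proof.
move=> oU; elim: k f g => [|k IH] f g Hf Hg; split=> //.
- by move=> x Ux; apply: (differentiableM (Dk_diff Hf Ux) (Dk_diff Hg Ux)).
- by move=> x Ux; apply: (differentiableM (Dk_diff Hf Ux) (Dk_diff Hg Ux)).
- move=> v; have H1 := IH _ _ (Dk_le Hf) (Hg.2 v).
  have H2 := IH _ _ (Dk_le Hg) (Hf.2 v).
  apply: (Dk_eq oU _ (DkD oU H1 H2)) => x Ux.
  have hf := diff_derivable (v := v) (Dk_diff Hf Ux).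
  have hg := diff_derivable (v := v) (Dk_diff Hg Ux).
  exact: esym (deriveM hf hg).
Qed.

(** The derivative of [1 / f] contains [1 / f] again, but one order lower: this
    is why the induction closes. *)
Lemma DkV (R : realType) (V : normedModType R) k (U : set V) f :
  open U -> (forall x, U x -> f x != 0) -> Dk k U f ->
  Dk k U (fun x => (f x)^-1).
Proof.
move=> oU f0; elim: k f f0 => [|k IH] f f0 Hf; split=> //.
- by move=> x Ux; apply: (differentiableV (Dk_diff Hf Ux)); exact: f0.
- by move=> x Ux; apply: (differentiableV (Dk_diff Hf Ux)); exact: f0.
- move=> v; have Hi := IH _ f0 (Dk_le Hf).
  have H := DkM oU (DkM oU (Dk_cst k U (-1)) (DkM oU Hi Hi)) (Hf.2 v).
  apply: (Dk_eq oU _ H) => x Ux; rewrite deriveV ?f0 //.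
    by rewrite -!mulrA mulN1r -[RHS]/(_ * _) mulNr expr2 invfM -mulrA.
  exact: diff_derivable (Dk_diff Hf Ux).
Qed.

(** * Rules for directional derivatives *)

(** Pointwise forms of the rules for sums, products and powers of functions,
    with multiplication in place of scaling. *)
Lemma is_derive_add (R : realType) (V : normedModType R) (f g : V -> R) x v
    (a b : R) :
  is_derive x v f a -> is_derive x v g b ->
  is_derive x v (fun y => f y + g y) (a + b).
Proof. exact: is_deriveD. Qed.

Lemma is_derive_sub (R : realType) (V : normedModType R) (f g : V -> R) x v
    (a b : R) :
  is_derive x v f a -> is_derive x v g b ->
  is_derive x v (fun y => f y - g y) (a - b).
Proof. exact: is_deriveB. Qed.

Lemma is_derive_mul (R : realType) (V : normedModType R) (f g : V -> R) x v
    (a b : R) :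
  is_derive x v f a -> is_derive x v g b ->
  is_derive x v (fun y => f y * g y) (f x * b + g x * a).
Proof. exact: is_deriveM. Qed.

Lemma is_derive_inv (R : realType) (V : normedModType R) (f : V -> R) x v
    (a : R) :
  f x != 0 -> is_derive x v f a ->
  is_derive x v (fun y => (f y)^-1) (- a / f x ^+ 2).
Proof.
move=> fx0 [df <-]; split; first exact: derivableV.
by rewrite deriveV // -[_ *: _]/(_ * _) mulNr mulrC mulNr.
Qed.

Lemma is_derive_div (R : realType) (V : normedModType R) (f g : V -> R) x v
    (a b : R) :
  g x != 0 -> is_derive x v f a -> is_derive x v g b ->
  is_derive x v (fun y => f y / g y) ((a * g x - f x * b) / g x ^+ 2).
Proof.
move=> gx0 df dg; have := is_derive_mul df (is_derive_inv gx0 dg).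
by move=> H; apply: is_derive_eq; field.
Qed.

Lemma is_derive_const (R : realType) (V : normedModType R) (c : R) (x v : V) :
  is_derive x v (fun=> c) 0.
Proof. exact: is_derive_cst. Qed.

Lemma is_derive_expS (R : realType) (V : normedModType R) (f : V -> R) x v n
    (a : R) :
  is_derive x v f a ->
  is_derive x v (fun y => f y ^+ n.+1) (n.+1%:R * f x ^+ n * a).
Proof.
move=> df; have H := is_deriveX n.+1 df.
have <- : f ^+ n.+1 = (fun y => f y ^+ n.+1) by apply/funext => y; rewrite exprfctE.
by [].
Qed.

(** * Smooth functions of one variable and composition *)

(** Meant for an open [W], where the existence of all iterated derivatives
    already makes them continuous. *)
Definition smooth1 (R : realType) (W : set R) (f : R -> R) : Prop :=
  forall k x, W x -> derivable (derive1n k f) x 1.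

Lemma smooth1_derive1 (R : realType) (W : set R) f :
  smooth1 W f -> smooth1 W (derive1 f).
Proof. by move=> sf k x Wx; rewrite -derive1Sn; exact: sf. Qed.

Lemma smooth1_derive1n (R : realType) (W : set R) f n :
  smooth1 W f -> smooth1 W (derive1n n f).
Proof.
by move=> sf k x Wx; rewrite /derive1n -iterD; exact: sf.
Qed.

Lemma smooth1_sub (R : realType) (W W' : set R) f :
  W' `<=` W -> smooth1 W f -> smooth1 W' f.
Proof. by move=> sW sf k x /sW; exact: sf. Qed.

Lemma smooth1_is_derive (R : realType) (W : set R) f x :
  smooth1 W f -> W x -> is_derive x 1 f (derive1 f x).
Proof.
by move=> sf Wx; rewrite derive1E; apply: derivableP; exact: (sf 0).
Qed.

Lemma smooth1_continuous (R : realType) (W : set R) f x :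
  smooth1 W f -> W x -> {for x, continuous f}.
Proof.
by move=> sf Wx; apply/differentiable_continuous/derivable1_diffP; exact: (sf 0).
Qed.

Lemma smooth1_id (R : realType) : smooth1 setT (@id R).
Proof.
have id1 : derive1 (@id R) = fun=> 1 by apply/funext => x; exact: derive1_id.
have cst0 (k : nat) (c : R) :
    exists c', derive1n k ((fun=> c) : R -> R) = (fun=> c').
  elim: k => [|k [c' IH]]; first by exists c.
  by exists 0; rewrite derive1nS IH; apply/funext => x; exact: derive1_cst.
case=> [|k] x _; first exact: derivable_id.
by rewrite derive1Sn id1; have [c ->] := cst0 k 1; exact: derivable_cst.
Qed.

Lemma Ck_smooth1 (R : realType) (W : set R) (f : R -> R) :
  (forall k, Ck k W f) -> smooth1 W f.
Proof.
have E (g : R -> R) : derive1 g = 'D_1 g.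
  by apply/funext => y; rewrite derive1E.
move=> H k x Wx; move: (H k.+1); elim: k f {H} => [|k IH] f [_ /(_ 1) [df Df]].
  exact: df.
by rewrite derive1Sn E; exact: IH Df.
Qed.

Lemma is_derive_comp1 (R : realType) (V : normedModType R) (f : R -> R)
    (E : V -> R) x v (df : R) :
  is_derive (E x) 1 f df -> differentiable E x ->
  differentiable (f \o E) x /\ 'D_v (f \o E) x = df * 'D_v E x.
Proof.
move=> [fd <-] dE; have dff := (derivable1_diffP _ _).1 fd.
have dfE := differentiable_comp dE dff; split => //.
rewrite (deriveE _ dfE) (deriveE _ dE) (deriveE _ dff) diff_comp //=.
by rewrite -{1}['d E x v]mulr1 [LHS]linearZ mulrC.
Qed.

(** One derivative of [f (E x)] is [f' (E x)] times a derivative of [E], which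
    has the same shape with one order less to prove. *)
Lemma Dk_comp1 (R : realType) (V : normedModType R) k (U : set V) (W : set R)
    (f : R -> R) (E : V -> R) :
  open U -> smooth1 W f -> (forall x, U x -> W (E x)) -> Dk k U E ->
  Dk k U (fun x => f (E x)).
Proof.
move=> oU + EW; elim: k f => [|k IH] f sf DE; split=> //.
- move=> x Ux; have fE := smooth1_is_derive sf (EW _ Ux).
  exact: (is_derive_comp1 0 fE (Dk_diff DE Ux)).1.
- move=> x Ux; have fE := smooth1_is_derive sf (EW _ Ux).
  exact: (is_derive_comp1 0 fE (Dk_diff DE Ux)).1.
- move=> v; have H := DkM oU (IH _ (smooth1_derive1 sf) (Dk_le DE)) (DE.2 v).
  apply: (Dk_eq oU _ H) => x Ux.
  have fE := smooth1_is_derive sf (EW _ Ux).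
  exact: esym (is_derive_comp1 v fE (Dk_diff DE Ux)).2.
Qed.

Lemma differentiable_fst (R : realType) (x : R * R) :
  differentiable (fst : R * R -> R) x.
Proof.
have c : continuous (fst : R * R -> R) by move=> y; exact: cvg_fst.
exact: linear_differentiable.
Qed.

Lemma differentiable_snd (R : realType) (x : R * R) :
  differentiable (snd : R * R -> R) x.
Proof.
have c : continuous (snd : R * R -> R) by move=> y; exact: cvg_snd.
exact: linear_differentiable.
Qed.

Lemma derive_fst (R : realType) (x v : R * R) : 'D_v (fst : R * R -> R) x = v.1.
Proof.
rewrite deriveE; last exact: differentiable_fst.
have c : continuous (fst : R * R -> R) by move=> y; exact: cvg_fst.
by rewrite diff_lin.
Qed.

Lemma derive_snd (R : realType) (x v : R * R) : 'D_v (snd : R * R -> R) x = v.2.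
Proof.
rewrite deriveE; last exact: differentiable_snd.
have c : continuous (snd : R * R -> R) by move=> y; exact: cvg_snd.
by rewrite diff_lin.
Qed.

Lemma Dk_fst (R : realType) k (U : set (R * R)) :
  open U -> Dk k U (fst : R * R -> R).
Proof.
move=> oU; case: k => [|k]; split=> //; try by move=> x _; exact: differentiable_fst.
by move=> v; apply: (Dk_eq oU _ (Dk_cst _ _ v.1)) => x _; rewrite derive_fst.
Qed.

Lemma Dk_snd (R : realType) k (U : set (R * R)) :
  open U -> Dk k U (snd : R * R -> R).
Proof.
move=> oU; case: k => [|k]; split=> //; try by move=> x _; exact: differentiable_snd.
by move=> v; apply: (Dk_eq oU _ (Dk_cst _ _ v.2)) => x _; rewrite derive_snd.
Qed.

(** By linearity, the differential of [f] is known from its values on the two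
    axis directions. *)
Lemma diff_comp_pair (R : realType) (V : normedModType R) (f : R * R -> R)
    (A B : V -> R) (x v : V) (a b : R) :
  differentiable f (A x, B x) -> differentiable A x -> differentiable B x ->
  'd A x v = a -> 'd B x v = b ->
  'd (fun y => f (A y, B y)) x v =
  a * 'd f (A x, B x) (1, 0) + b * 'd f (A x, B x) (0, 1).
Proof.
move=> df dA dB ea eb.
have dP := differentiable_pair dA dB.
have H := diff_comp dP df.
transitivity ('d f (A x, B x) ('d (fun y => (A y, B y)) x v)).
  have := congr1 (fun g => g v) H.
  exact.
have E : 'd (fun y => (A y, B y)) x v =
    a *: ((1, 0) : R * R) + b *: ((0, 1) : R * R).
  transitivity (a, b).
    have H2 := congr1 (fun g => g v) (diff_pair dA dB).
    by apply: etrans H2 _; congr pair.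
  congr pair => /=; rewrite -![_ *: _]/(_ * _);
    by rewrite ?mulr1 ?mulr0 ?addr0 ?add0r.
transitivity ('d f (A x, B x) (a *: ((1, 0) : R * R) + b *: ((0, 1) : R * R))).
  exact: congr1 E.
by rewrite linearD !linearZ.
Qed.

Lemma derive_prod_map (R : realType) (f : R * R -> R) (P : R -> R)
    (x v : R * R) (a b : R) :
  is_derive x.1 1 P a -> is_derive x.2 1 P b ->
  differentiable f (P x.1, P x.2) ->
  let fP := fun y : R * R => f (P y.1, P y.2) in
  differentiable fP x /\
  'D_v fP x = v.1 * a * 'D_(1, 0) f (P x.1, P x.2) +
              v.2 * b * 'D_(0, 1) f (P x.1, P x.2).
Proof.
move=> Pa Pb df fP.
have [d1 e1] := is_derive_comp1 v Pa (differentiable_fst x).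
have [d2 e2] := is_derive_comp1 v Pb (differentiable_snd x).
have dP := differentiable_pair d1 d2.
have dfP : differentiable fP x by exact: (differentiable_comp dP df).
split => //; rewrite (deriveE _ dfP) !(deriveE _ df).
apply: (diff_comp_pair df d1 d2).
  by rewrite -(deriveE _ d1) e1 derive_fst mulrC.
by rewrite -(deriveE _ d2) e2 derive_snd mulrC.
Qed.

(** A derivative of the composite is a combination of the two partial
    derivatives of [f], composed with the same map, with coefficients that are
    smooth functions of one coordinate; hence induction on [k]. *)
Lemma Dk_prod_map (R : realType) k (U U' : set (R * R)) (W : set R) f P :
  open U -> smooth1 W P -> (forall x, U x -> W x.1 /\ W x.2) ->
  (forall x, U x -> U' (P x.1, P x.2)) -> Dk k U' f ->
  Dk k U (fun x => f (P x.1, P x.2)).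
Proof.
move=> oU sP UW UU'.
have dP x : U x ->
    is_derive x.1 1 P (derive1 P x.1) /\ is_derive x.2 1 P (derive1 P x.2).
  by move=> /UW [W1 W2]; split; apply: smooth1_is_derive sP _.
elim: k f => [|k IH] f Df; split=> //.
- move=> x Ux; have [P1 P2] := dP _ Ux.
  exact: (derive_prod_map 0 P1 P2 (Dk_diff Df (UU' _ Ux))).1.
- move=> x Ux; have [P1 P2] := dP _ Ux.
  exact: (derive_prod_map 0 P1 P2 (Dk_diff Df (UU' _ Ux))).1.
- move=> v.
  have DP1 := Dk_comp1 oU (smooth1_derive1 sP) (fun x Ux => (UW x Ux).1)
    (Dk_fst k oU).
  have DP2 := Dk_comp1 oU (smooth1_derive1 sP) (fun x Ux => (UW x Ux).2)
    (Dk_snd k oU).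
  have H := DkD oU
    (DkM oU (DkM oU (Dk_cst k U v.1) DP1) (IH _ (Df.2 (1, 0))))
    (DkM oU (DkM oU (Dk_cst k U v.2) DP2) (IH _ (Df.2 (0, 1)))).
  apply: (Dk_eq oU _ H) => x Ux; have [P1 P2] := dP _ Ux.
  exact: esym (derive_prod_map v P1 P2 (Dk_diff Df (UU' _ Ux))).2.
Qed.

(** * Taylor remainders *)

(** At a zero of [a], the increment of [a * b] is that of [a] times a value of
    [b] nearby; continuity of [b] is enough. This gives differentiability of the
    Taylor quotients at diagonal points, where they are written as [a * b] with
    [b] not yet known to be differentiable. *)
Lemma diff_mul_zero (R : realType) (V : normedModType R) (a b : V -> R) x w :
  differentiable a x -> {for x, continuous b} -> a x = 0 ->
  differentiable (fun y => a y * b y) x /\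
  'D_w (fun y => a y * b y) x = b x * 'D_w a x.
Proof.
move=> da cb ax0.
have [k k0 lip] := linear_lipschitz (diff_continuous da).
have dba := differentiableZ (b x) da.
have LE h : 'd (b x *: a) x h = b x * 'd a x h.
  by have /= := congr1 (fun g => g h) (diffZ (b x) da).
have eps (e : R) : 0 < e -> \forall h \near (0 : V),
    `|a (h + x) * b (h + x) - a x * b x - 'd (b x *: a) x h| <= e * `|h|.
  (* [e1] bounds the error of the linear approximation of [a], [e2] the
     oscillation of [b]; each accounts for half of [e]. *)
  move=> e0; pose e1 := e / 2 / (`|b x| + 1); pose e2 := e / 2 / (k + e1).
  have bx0 : 0 < `|b x| + 1 by rewrite ltr_wpDl.
  have e10 : 0 < e1 by rewrite !divr_gt0.
  have ke0 : 0 < k + e1 by rewrite addr_gt0.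
  have e20 : 0 < e2 by rewrite !divr_gt0.
  have E1 : (`|b x| + 1) * e1 = e / 2 by rewrite mulrC divfK ?gt_eqF.
  have E2 : (k + e1) * e2 = e / 2 by rewrite mulrC divfK ?gt_eqF.
  have Ha : \forall h \near (0 : V), `|a (h + x) - 'd a x h| <= e1 * `|h|.
    have [_ /eqaddoP/(_ e1 e10)] := (diff_locallyP _ _).1 da.
    by apply: filterS => h /=; rewrite fctE /= opprD addrA /cst ax0 subr0.
  have Hb : \forall h \near (0 : V), `|b x - b (h + x)| < e2.
    rewrite (near_shift x (0 : V)) /=.
    have H : \forall y \near x, `|b x - b y| < e2.
      by move/cvgrPdist_lt: cb; exact.
    by apply: filterS H => y; rewrite /= sub0r subrK.
  apply: filterS2 Ha Hb => h Ha Hb; rewrite LE ax0 mul0r subr0.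
  have -> : a (h + x) * b (h + x) - b x * 'd a x h =
    - (a (h + x) * (b x - b (h + x))) + b x * (a (h + x) - 'd a x h) by ring.
  have Ka : `|a (h + x)| <= (k + e1) * `|h|.
    rewrite -(subrK ('d a x h) (a (h + x))) (le_trans (ler_normD _ _)) //.
    by rewrite mulrDl addrC lerD.
  rewrite (le_trans (ler_normD _ _)) // normrN !normrM.
  have -> : e * `|h| = (k + e1) * `|h| * e2 + (`|b x| + 1) * (e1 * `|h|).
    by rewrite [(k + e1) * _ * _]mulrAC E2 mulrA E1 -mulrDl -splitr.
  apply: lerD; first by apply: ler_pM => //; exact: ltW.
  by apply: ler_pM => //; rewrite lerDl.
have [df dE] := @differentiable_eps _ _ (fun y => a y * b y) _ _
  (diff_continuous dba) eps.
split=> //; rewrite (deriveE _ df) (deriveE _ da) -LE.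
by have := congr1 (fun g => g w) dE.
Qed.

Definition taylor_rem (R : realType) (n : nat) (f : R -> R) (u v : R) : R :=
  f v - \sum_(k < n) derive1n k f u / (k`!)%:R * (v - u) ^+ k.

Lemma taylor_rem_diag (R : realType) n (f : R -> R) u :
  taylor_rem n.+1 f u u = 0.
Proof.
rewrite /taylor_rem big_ord_recl /= subrr expr0 fact0 divr1 mulr1.
by rewrite big1 ?addr0 ?subrr // => i _; rewrite exprS mul0r mulr0.
Qed.

Lemma taylor_remS (R : realType) n (f : R -> R) u v :
  taylor_rem n.+1 f u v =
  taylor_rem n f u v - derive1n n f u / (n`!)%:R * (v - u) ^+ n.
Proof. by rewrite /taylor_rem big_ord_recr /= opprD addrA. Qed.

(** Differentiation in the end point passes to the derivative of [f] and lowers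
    the order by one; the estimate of the remainder goes by induction on this. *)
Lemma is_derive_taylor_rem (R : realType) (W : set R) n f u v :
  smooth1 W f -> W v ->
  is_derive v 1 (taylor_rem n.+1 f u) (taylor_rem n (derive1 f) u v).
Proof.
move=> sf Wv.
have -> : taylor_rem n.+1 f u = fun v =>
    f v - (f u + \sum_(k < n) derive1n k (derive1 f) u / (k.+1`!)%:R *
                              (v - u) ^+ k.+1).
  apply/funext => z; rewrite /taylor_rem big_ord_recl /= expr0 fact0 divr1 mulr1.
  congr (_ - (_ + _)); apply: eq_bigr => k _.
  by rewrite -derive1Sn.
have dX (k : nat) :
    is_derive v 1 (fun y : R => (y - u) ^+ k.+1) (k.+1%:R * (v - u) ^+ k).
  have d1 : is_derive v 1 (fun y : R => y - u) (1 - 0).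
    exact: (is_derive_sub (is_derive_id v 1) (is_derive_const u v 1)).
  have H := is_derive_expS k d1.
  by apply: (is_derive_eq H); rewrite subr0 mulr1.
pose F (k : 'I_n) y := derive1n k (derive1 f) u / (k.+1`!)%:R * (y - u) ^+ k.+1.
have dF k : is_derive v 1 (F k) (derive1n k (derive1 f) u / (k`!)%:R * (v - u) ^+ k).
  have H := is_derive_mul
    (is_derive_const (derive1n k (derive1 f) u / (k.+1`!)%:R) v 1) (dX k).
  apply: (is_derive_eq H); rewrite mulr0 addr0 factS natrM.
  by field; rewrite addrC natr1 !pnatr_eq0 -!lt0n fact_gt0.
have := is_derive_sub (smooth1_is_derive sf Wv)
  (is_derive_add (is_derive_const (f u) v 1) (is_derive_sum dF)).
rewrite add0r; congr is_derive.
by apply/funext => z; rewrite fct_sumE.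
Qed.

(** * Taylor quotients *)

Lemma mean_value_ball (R : realType) (g dg : R -> R) (t d a b : R) :
  (forall x, `|x - t| < d -> is_derive x 1 g (dg x)) ->
  `|a - t| < d -> `|b - t| < d ->
  exists c, [/\ `|c - t| < d, `|c - a| <= `|b - a| &
                g b - g a = dg c * (b - a)].
Proof.
move=> Dg.
have main x y : x <= y -> `|x - t| < d -> `|y - t| < d ->
    exists c, [/\ `|c - t| < d, x <= c, c <= y & g y - g x = dg c * (y - x)].
  move=> xy xd yd.
  have inball z : z \in `[x, y]%R -> `|z - t| < d.
    rewrite in_itv /= => /andP[xz zy]; move: xd yd; rewrite !ltr_norml.
    by move=> /andP[? ?] /andP[? ?]; apply/andP; split; lra.
  have Dxy z : z \in `[x, y]%R -> derivable g z 1 by move=> /inball /Dg [].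
  have [c cxy E] := MVT_segment xy
    (fun z zxy => Dg z (inball z (subset_itv_oo_cc zxy)))
    (derivable_within_continuous Dxy).
  have := cxy; rewrite in_itv /= => /andP[xc cy].
  by exists c; split => //; exact: inball.
move=> ad bd; have [ab|/ltW ba] := leP a b.
  have [c [cd ac cb E]] := main _ _ ab ad bd.
  by exists c; split => //; rewrite !ger0_norm ?subr_ge0 //; lra.
have [c [cd bc ca E]] := main _ _ ba bd ad.
exists c; split => //; last by rewrite -opprB E; ring.
by rewrite !ler0_norm ?subr_le0 //; lra.
Qed.

(** The remainder vanishes at [v = u] and its derivative in [v] is a remainder of
    [derive1 f], so the mean value theorem gains one power of [v - u]. The start
    of the induction is the continuity of [f] at [t]. All estimates are uniform
    in the base point [u], as continuity in two variables requires. *)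
Lemma taylor_rem_small (R : realType) (W : set R) n f (t e : R) :
  open W -> smooth1 W f -> W t -> 0 < e ->
  exists2 d, 0 < d & forall u v, `|u - t| < d -> `|v - t| < d ->
    `|taylor_rem n.+1 f u v| <= e * `|v - u| ^+ n.
Proof.
move=> oW + Wt; elim: n f e => [|n IH] f e sf e0.
  have e20 : 0 < e / 2 by rewrite divr_gt0.
  have /cvgrPdist_lt/(_ _ e20)/nbhs_ballP [d d0 H] := smooth1_continuous sf Wt.
  exists d => // u v ud vd; rewrite expr0 mulr1.
  have -> : taylor_rem 1 f u v = (f t - f u) - (f t - f v).
    by rewrite /taylor_rem big_ord1 expr0 fact0 divr1 mulr1 /=; ring.
  have Hu : `|f t - f u| < e / 2 by apply: H; rewrite /ball /= distrC.
  have Hv : `|f t - f v| < e / 2 by apply: H; rewrite /ball /= distrC.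
  rewrite (le_trans (ler_normB _ _)) // (splitr e); apply: lerD; exact: ltW.
have [d1 d10 H1] := IH _ _ (smooth1_derive1 sf) e0.
have /nbhs_ballP [d2 d20 H2] : nbhs t W by exact: open_nbhs_nbhs.
exists (Num.min d1 d2) => [|u v]; first by rewrite lt_min d10 d20.
rewrite !lt_min => /andP[ud1 ud2] /andP[vd1 vd2].
have Dg z : `|z - t| < Num.min d1 d2 ->
    is_derive z 1 (taylor_rem n.+2 f u) (taylor_rem n.+1 (derive1 f) u z).
  rewrite lt_min => /andP[_ zd2]; apply: (is_derive_taylor_rem _ _ sf).
  by apply: H2; rewrite /ball /= distrC.
have um : `|u - t| < Num.min d1 d2 by rewrite lt_min ud1.
have vm : `|v - t| < Num.min d1 d2 by rewrite lt_min vd1.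
have [c [+ cu E]] := mean_value_ball Dg um vm.
rewrite lt_min => /andP[cd1 _].
move: E; rewrite taylor_rem_diag subr0 => ->; rewrite normrM exprSr mulrA.
apply: ler_wpM2r => //; apply: le_trans (H1 _ _ ud1 cd1) _.
apply: ler_wpM2l; first exact: ltW.
by rewrite lerXn2r ?nnegrE.
Qed.

(** Taylor's remainder divided by the matching power of [p.2 - p.1], with the
    value on the diagonal that makes it continuous. *)
Definition tquot (R : realType) (n : nat) (f : R -> R) (p : R * R) : R :=
  if p.1 == p.2 then derive1n n f p.1 / (n`!)%:R
  else taylor_rem n f p.1 p.2 / (p.2 - p.1) ^+ n.

Lemma tquot_diag (R : realType) n (f : R -> R) t :
  tquot n f (t, t) = derive1n n f t / (n`!)%:R.
Proof. by rewrite /tquot eqxx. Qed.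

Lemma tquot0 (R : realType) (f : R -> R) p : tquot 0 f p = f p.2.
Proof.
rewrite /tquot /taylor_rem big_ord0 expr0 fact0 !divr1 subr0.
by case: eqP => [->|].
Qed.

(** This also holds on the diagonal, hence presents a quotient near a diagonal
    point as a smooth function plus [p.2 - p.1] times a continuous one. *)
Lemma tquotS (R : realType) n (f : R -> R) p :
  tquot n f p =
  derive1n n f p.1 / (n`!)%:R + (p.2 - p.1) * tquot n.+1 f p.
Proof.
rewrite /tquot; case: eqP => [->|/eqP d]; first by rewrite subrr mul0r addr0.
have d0 : p.2 - p.1 != 0 by rewrite subr_eq0 eq_sym.
rewrite taylor_remS exprS; set r := taylor_rem _ _ _ _; set c := _ / _%:R.
by field; rewrite expf_neq0.
Qed.

Lemma tquot_continuous_diag (R : realType) (W : set R) n f t :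
  open W -> smooth1 W f -> W t -> {for (t, t), continuous (tquot n f)}.
Proof.
move=> oW sf Wt; apply/cvgrPdist_le => e e0.
have e20 : 0 < e / 2 by rewrite divr_gt0.
have nf0 : 0 < (n`!)%:R :> R by rewrite ltr0n fact_gt0.
have [d d0 H] := taylor_rem_small n oW sf Wt e20.
have cf := smooth1_continuous (smooth1_derive1n (n := n) sf) Wt.
have e3 : 0 < e / 2 * (n`!)%:R by rewrite mulr_gt0.
have /cvgrPdist_lt/(_ _ e3)/nbhs_ballP [d' d'0 H'] := cf.
have m0 : 0 < Num.min d d' by rewrite lt_min d0 d'0.
have N := nbhsx_ballx ((t, t) : R * R) _ m0.
apply: filterS N => -[u v] [/=].
rewrite /ball /= !lt_min !(distrC t) => /andP[ud ud'] /andP[vd vd'].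
rewrite tquot_diag distrC.
have -> : tquot n f (u, v) - derive1n n f t / (n`!)%:R =
   (tquot n f (u, v) - derive1n n f u / (n`!)%:R) +
   (derive1n n f u - derive1n n f t) / (n`!)%:R by ring.
rewrite (le_trans (ler_normD _ _)) // (splitr e) lerD //.
  rewrite /tquot /=; case: eqP => [_|/eqP uv].
    by rewrite subrr normr0 ltW.
  have d0' : v - u != 0 by rewrite subr_eq0 eq_sym.
  have -> : taylor_rem n f u v / (v - u) ^+ n - derive1n n f u / (n`!)%:R =
      taylor_rem n.+1 f u v / (v - u) ^+ n.
    rewrite taylor_remS; set r := taylor_rem _ _ _ _; set c := _ / _%:R.
    by field; rewrite expf_neq0.
  rewrite normrM normfV normrX ler_pdivrMr ?exprn_gt0 ?normr_gt0 //.
  exact: H.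
rewrite normrM normfV (gtr0_norm nf0) ler_pdivrMr //.
by rewrite distrC ltW // H' // /ball /= distrC.
Qed.

(** The partial derivatives of a Taylor quotient are again combinations of Taylor
    quotients, of [f] and of [derive1 f]. This is what makes all of them
    infinitely differentiable across the diagonal. *)
Lemma tquot_diff (R : realType) (W : set R) n f p w :
  open W -> smooth1 W f -> W p.1 -> W p.2 ->
  differentiable (tquot n f) p /\
  'D_w (tquot n f) p = w.1 * (n%:R * tquot n.+1 f p) +
    w.2 * (tquot n (derive1 f) p - n%:R * tquot n.+1 f p).
Proof.
move=> oW sf; case: p => u v /= Wu Wv.
have dfst k : differentiable (fun q : R * R => derive1n k f q.1 / (k`!)%:R) (u, v) /\
    'D_w (fun q : R * R => derive1n k f q.1 / (k`!)%:R) (u, v) =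
     derive1n k.+1 f u / (k`!)%:R * w.1.
  have fk : is_derive (u, v).1 1 (fun z => derive1n k f z / (k`!)%:R)
      (derive1n k.+1 f u / (k`!)%:R).
    have d1 : is_derive u 1 (derive1n k f) (derive1n k.+1 f u).
      exact: smooth1_is_derive (smooth1_derive1n (n := k) sf) Wu.
    apply: (is_derive_eq (is_derive_mul d1 (is_derive_const _ _ _))).
    by rewrite mulr0 add0r mulrC.
  have [d e] := is_derive_comp1 w fk (differentiable_fst (u, v)).
  by split=> //; rewrite -(derive_fst (u, v) w).
have dsub : differentiable (fun q : R * R => q.2 - q.1) (u, v).
  exact: (differentiableB (differentiable_snd _) (differentiable_fst _)).
have esub : 'D_w (fun q : R * R => q.2 - q.1) (u, v) = w.2 - w.1.
  rewrite -(derive_fst (u, v) w) -(derive_snd (u, v) w).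
  by apply: deriveB; apply: diff_derivable;
    [exact: differentiable_snd|exact: differentiable_fst].
have [uv|uv] := eqVneq u v.
  (* Near a diagonal point, [tquotS] and continuity of the next quotient. *)
  subst v.
  have -> : tquot n f = fun q =>
      derive1n n f q.1 / (n`!)%:R + (q.2 - q.1) * tquot n.+1 f q.
    by apply/funext => q; exact: tquotS.
  have [d1 e1] := dfst n.
  have [d2 e2] := diff_mul_zero w dsub (tquot_continuous_diag (n := n.+1) oW sf Wu)
    (subrr u).
  split; first exact: (differentiableD d1 d2).
  have -> := deriveD (diff_derivable (v := w) d1) (diff_derivable (v := w) d2).
  rewrite e1 e2 esub !tquot_diag -derive1Sn factS natrM.
  by field; rewrite addrC natr1 !pnatr_eq0 -!lt0n fact_gt0.
(* Away from the diagonal, solve [tquotS] for the next quotient. *)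
elim: n => [|n [dn en]].
  have -> : tquot 0 f = f \o snd by apply/funext => q; exact: tquot0.
  have fv : is_derive (u, v).2 1 f (derive1 f v) := smooth1_is_derive sf Wv.
  have [d ->] := is_derive_comp1 w fv (differentiable_snd (u, v)).
  by split=> //; rewrite derive_snd !mul0r mulr0 add0r subr0 tquot0 mulrC.
have [d1 e1] := dfst n.
have d0 : v - u != 0 by rewrite subr_eq0 eq_sym.
pose G q := (tquot n f q - derive1n n f q.1 / (n`!)%:R) / (q.2 - q.1).
have nE : \forall q \near (u, v), G q = tquot n.+1 f q.
  have : \forall q \near (u, v), q.2 - q.1 != 0.
    have /differentiable_continuous := dsub.
    by move=> c; exact: (c _ (open_nbhs_nbhs (conj (@open_neq _ 0) d0))).
  by apply: filterS => q q0; rewrite /G tquotS addrC addKr mulrC mulKf.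
have dnum := differentiableB dn d1.
have dG : differentiable G (u, v).
  exact: (differentiableM dnum (differentiableV dsub d0)).
split; first exact: near_eq_differentiable nE dG.
rewrite -(near_eq_derive _ nE).
have iN : is_derive (u, v) w (fun q => tquot n f q - derive1n n f q.1 / (n`!)%:R)
    ('D_w (tquot n f) (u, v) - derive1n n.+1 f u / (n`!)%:R * w.1).
  rewrite -e1; apply: is_derive_sub; apply: derivableP; exact: diff_derivable.
have iS : is_derive (u, v) w (fun q : R * R => q.2 - q.1) (w.2 - w.1).
  by rewrite -esub; apply: derivableP; exact: diff_derivable.
have [_ ->] := @is_derive_div _ _ _ (fun q : R * R => q.2 - q.1) (u, v) w _ _
  d0 iN iS.
rewrite en (tquotS n (derive1 f)) (tquotS n f) (tquotS n.+1 f) -derive1Sn /=.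
rewrite factS natrM -natr1.
set a := tquot _ f _; set b := tquot _ _ _; set c0 := derive1n n f u.
set c1 := derive1n n.+1 f u; set F := (n`!)%:R : R; set m := n%:R : R.
have F0 : F != 0 by rewrite pnatr_eq0 -lt0n fact_gt0.
have m0 : m + 1 != 0 by rewrite natr1 pnatr_eq0.
by field; rewrite d0 F0 m0.
Qed.

Lemma open_square (R : realType) (W : set R) :
  open W -> open [set p : R * R | W p.1 /\ W p.2].
Proof.
move=> oW; rewrite openE => p [W1 W2]; exists (W, W); last by move=> q [].
by split; exact: open_nbhs_nbhs.
Qed.

Lemma Dk_tquot (R : realType) (W : set R) k n f :
  open W -> smooth1 W f -> Dk k [set p | W p.1 /\ W p.2] (tquot n f).
Proof.
move=> oW; elim: k n f => [|k IH] n f sf; split=> //.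
- by move=> p [W1 W2]; exact: (tquot_diff n 0 oW sf W1 W2).1.
- by move=> p [W1 W2]; exact: (tquot_diff n 0 oW sf W1 W2).1.
- move=> w; have oU := open_square oW.
  have H1 := DkM oU (Dk_cst k _ n%:R) (IH n.+1 f sf).
  have H2 := DkM oU (Dk_cst k _ (-1)) H1.
  have H3 := DkD oU (IH n _ (smooth1_derive1 sf)) H2.
  have H := DkD oU (DkM oU (Dk_cst k _ w.1) H1) (DkM oU (Dk_cst k _ w.2) H3).
  apply: (Dk_eq oU _ H) => p [W1 W2].
  by rewrite (tquot_diff n w oW sf W1 W2).2 mulN1r.
Qed.

(** * Mixed logarithmic derivatives *)

Notation dir1 := ((1, 0) : (Real.sort _ * Real.sort _)%type).
Notation dir2 := ((0, 1) : (Real.sort _ * Real.sort _)%type).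

(** The mixed second partial derivative of [ln `|K|]. As a rational expression
    in the derivatives of [K] it is visibly smooth where [K] does not vanish. *)
Definition mixlog (R : realType) (K : R * R -> R) (p : R * R) : R :=
  (K p * 'D_dir1 ('D_dir2 K) p - 'D_dir1 K p * 'D_dir2 K p) / K p ^+ 2.

Lemma mixlogE (R : realType) (K : R * R -> R) (p : R * R) (d1 d2 d12 : R) :
  'D_dir1 K p = d1 -> 'D_dir2 K p = d2 -> 'D_dir1 ('D_dir2 K) p = d12 ->
  mixlog K p = (K p * d12 - d1 * d2) / K p ^+ 2.
Proof. by move=> <- <- <-. Qed.

Lemma Dk_mixlog (R : realType) (U : set (R * R)) K :
  open U -> (forall p, U p -> K p != 0) -> (forall k, Dk k U K) ->
  forall k, Dk k U (mixlog K).
Proof.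
move=> oU K0 DK k.
have D12 := (((DK k.+2).2 dir2).2 dir1).
have Ki := DkV oU K0 (DK k).
have H := DkD oU (DkM oU (DK k) D12)
  (DkM oU (Dk_cst k U (-1)) (DkM oU ((DK k.+1).2 dir1) ((DK k.+1).2 dir2))).
apply: (Dk_eq oU _ (DkM oU H (DkM oU Ki Ki))) => p Up.
by rewrite /mixlog mulN1r expr2 invfM.
Qed.

Lemma Dk_is_derive (R : realType) (V : normedModType R) k (U : set V) f x v :
  Dk k U f -> U x -> is_derive x v f ('D_v f x).
Proof.
by move=> Df Ux; apply: derivableP; apply: diff_derivable; exact: Dk_diff Df Ux.
Qed.

Lemma Dk_derive (R : realType) (V : normedModType R) k (U : set V) f v :
  Dk k.+1 U f -> Dk k U ('D_v f).
Proof. by move=> [_ Df]; exact: Df. Qed.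

(** The logarithm of a product is the sum of the logarithms. *)
Lemma mixlog_mul (R : realType) (U : set (R * R)) K L p :
  open U -> Dk 2 U K -> Dk 2 U L -> U p -> K p != 0 -> L p != 0 ->
  mixlog (fun q => K q * L q) p = mixlog K p + mixlog L p.
Proof.
move=> oU DK DL Up K0 L0.
have D v q : U q -> 'D_v (fun q => K q * L q) q =
    K q * 'D_v L q + L q * 'D_v K q.
  by move=> Uq; have [_ ->] :=
    is_derive_mul (Dk_is_derive v DK Uq) (Dk_is_derive v DL Uq).
have D12 : 'D_dir1 ('D_dir2 (fun q => K q * L q)) p =
    (K p * 'D_dir1 ('D_dir2 L) p + 'D_dir2 L p * 'D_dir1 K p) +
    (L p * 'D_dir1 ('D_dir2 K) p + 'D_dir2 K p * 'D_dir1 L p).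
  rewrite (near_eq_derive _ (near_of_open oU (D dir2) Up)).
  have iK := Dk_is_derive dir1 DK Up; have iL := Dk_is_derive dir1 DL Up.
  have iK2 := Dk_is_derive dir1 (Dk_derive dir2 DK) Up.
  have iL2 := Dk_is_derive dir1 (Dk_derive dir2 DL) Up.
  by have [_ ->] := is_derive_add (is_derive_mul iK iL2) (is_derive_mul iL iK2).
rewrite (mixlogE (D dir1 p Up) (D dir2 p Up) D12).
rewrite (mixlogE (K := K) erefl erefl erefl) (mixlogE (K := L) erefl erefl erefl).
set k := K p in K0 *; set l := L p in L0 *.
move: ('D_dir1 ('D_dir2 K) p) ('D_dir1 ('D_dir2 L) p) => k12 l12.
move: ('D_dir1 K p) ('D_dir2 K p) ('D_dir1 L p) ('D_dir2 L p) => k1 k2 l1 l2.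
by field; rewrite K0 L0.
Qed.

Lemma derive_comp_fst (R : realType) (a : R -> R) da (p v : R * R) :
  is_derive p.1 1 a da -> is_derive p v (fun q => a q.1) (da * v.1).
Proof.
move=> ia; have [d e] := is_derive_comp1 v ia (differentiable_fst p).
by rewrite -(derive_fst p v) -e; apply: derivableP; exact: diff_derivable.
Qed.

Lemma derive_comp_snd (R : realType) (a : R -> R) da (p v : R * R) :
  is_derive p.2 1 a da -> is_derive p v (fun q => a q.2) (da * v.2).
Proof.
move=> ia; have [d e] := is_derive_comp1 v ia (differentiable_snd p).
by rewrite -(derive_snd p v) -e; apply: derivableP; exact: diff_derivable.
Qed.

(** A factor depending on one variable only is killed by the mixed derivative. *)
Lemma mixlog_comp_fst (R : realType) (U : set (R * R)) (W : set R) a p :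
  open U -> (forall q, U q -> W q.1) -> smooth1 W a -> U p ->
  mixlog (fun q => a q.1) p = 0.
Proof.
move=> oU UW sa Up.
have D2 q : U q -> 'D_dir2 (fun q : R * R => a q.1) q = 0.
  move=> Uq; have [_ ->] := derive_comp_fst dir2 (smooth1_is_derive sa (UW _ Uq)).
  by rewrite mulr0.
have D12 : 'D_dir1 ('D_dir2 (fun q : R * R => a q.1)) p = 0.
  rewrite (near_eq_derive _ (near_of_open oU D2 Up)).
  by have [_ ->] := is_derive_const 0 p dir1.
by rewrite (mixlogE erefl (D2 p Up) D12) !mulr0 subrr mul0r.
Qed.

Lemma mixlog_comp_snd (R : realType) (U : set (R * R)) (W : set R) a p :
  open U -> (forall q, U q -> W q.2) -> smooth1 W a -> U p ->
  mixlog (fun q => a q.2) p = 0.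
Proof.
move=> oU UW sa Up.
have D q v : U q -> 'D_v (fun q : R * R => a q.2) q = derive1 a q.2 * v.2.
  by move=> Uq; have [_ ->] := derive_comp_snd v (smooth1_is_derive sa (UW _ Uq)).
have D12 : 'D_dir1 ('D_dir2 (fun q : R * R => a q.2)) p = 0.
  rewrite (near_eq_derive _ (near_of_open oU (D ^~ dir2) Up)).
  have sa1 := smooth1_is_derive (smooth1_derive1 sa) (UW _ Up).
  have [_ ->] := is_derive_mul (derive_comp_snd dir1 sa1)
    (is_derive_const 1 p dir1).
  by rewrite /= !mulr0 addr0.
by rewrite (mixlogE (D p dir1 Up) erefl D12) /= !mulr0 mul0r subrr mul0r.
Qed.

(** The first coordinate of the map depends on the first variable only and the
    second one on the second only, so each partial derivative picks up one
    factor [P'] and no second derivative of [P] appears. *)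
Lemma mixlog_prod_map (R : realType) (U U' : set (R * R)) (W : set R) K P p :
  open U -> smooth1 W P -> (forall q, U q -> W q.1 /\ W q.2) ->
  (forall q, U q -> U' (P q.1, P q.2)) -> Dk 2 U' K -> U p ->
  K (P p.1, P p.2) != 0 ->
  mixlog (fun q => K (P q.1, P q.2)) p =
  mixlog K (P p.1, P p.2) * derive1 P p.1 * derive1 P p.2.
Proof.
move=> oU sP UW UU' DK Up K0.
have D L v q : Dk 1 U' L -> U q ->
    is_derive q v (fun q => L (P q.1, P q.2))
      (v.1 * derive1 P q.1 * 'D_dir1 L (P q.1, P q.2) +
       v.2 * derive1 P q.2 * 'D_dir2 L (P q.1, P q.2)).
  move=> DL Uq; have [W1 W2] := UW _ Uq.
  have [d <-] := derive_prod_map v (smooth1_is_derive sP W1)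
    (smooth1_is_derive sP W2) (Dk_diff DL (UU' _ Uq)).
  by apply: derivableP; exact: diff_derivable.
have DK1 := Dk_le DK.
have D1 q : U q -> 'D_dir1 (fun q => K (P q.1, P q.2)) q =
    derive1 P q.1 * 'D_dir1 K (P q.1, P q.2).
  by move=> Uq; have [_ ->] := D _ dir1 _ DK1 Uq; rewrite /= mul1r !mul0r addr0.
have D2 q : U q -> 'D_dir2 (fun q => K (P q.1, P q.2)) q =
    derive1 P q.2 * 'D_dir2 K (P q.1, P q.2).
  by move=> Uq; have [_ ->] := D _ dir2 _ DK1 Uq; rewrite /= mul1r !mul0r add0r.
have D12 : 'D_dir1 ('D_dir2 (fun q => K (P q.1, P q.2))) p =
    derive1 P p.2 * derive1 P p.1 * 'D_dir1 ('D_dir2 K) (P p.1, P p.2).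
  rewrite (near_eq_derive _ (near_of_open oU D2 Up)).
  have i1 := derive_comp_snd dir1
    (smooth1_is_derive (smooth1_derive1 sP) (UW _ Up).2).
  have i2 := D _ dir1 _ (Dk_derive dir2 DK) Up.
  have [_ ->] := is_derive_mul i1 i2.
  set a := 'D_dir1 _ _; set b := 'D_dir2 _ _; set c := 'D_dir2 K _.
  by move: a b c => a b c; rewrite mulr0 mulr0 addr0 mul1r !mul0r addr0 mulrA.
rewrite (mixlogE (D1 p Up) (D2 p Up) D12).
rewrite (mixlogE (K := K) erefl erefl erefl); set k := K _ in K0 *.
move: ('D_dir1 ('D_dir2 K) _) ('D_dir1 K _) ('D_dir2 K _) => k12 k1 k2.
by field.
Qed.

(** The origin of the Schwarzian derivative: on the diagonal, the difference
    quotient [K] of [P] has [K = P'], both first partial derivatives [P'' / 2] and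
    mixed derivative [P''' / 6], so that [K K_12 - K_1 K_2] over [K ^ 2] is
    [P''' / (6 P') - (P'' / (2 P')) ^ 2]. *)
Lemma mixlog_tquot1_diag (R : realType) (W : set R) P s :
  open W -> smooth1 W P -> W s -> derive1 P s != 0 ->
  mixlog (tquot 1 P) (s, s) =
  6^-1 * (derive1n 3 P s / derive1 P s -
          3 / 2 * (derive1n 2 P s / derive1 P s) ^+ 2).
Proof.
move=> oW sP Ws P0.
have sP1 := smooth1_derive1 sP.
have oU := open_square oW; set U := [set p : R * R | _] in oU.
have Us : U (s, s) by split.
have D n f w q : smooth1 W f -> U q ->
    'D_w (tquot n f) q = w.1 * (n%:R * tquot n.+1 f q) +
    w.2 * (tquot n (derive1 f) q - n%:R * tquot n.+1 f q).
  by move=> sf [W1 W2]; exact: (tquot_diff n w oW sf W1 W2).2.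
have D2 q : U q -> 'D_dir2 (tquot 1 P) q = tquot 1 (derive1 P) q - tquot 2 P q.
  by move=> Uq; rewrite D //= mul0r add0r !mul1r.
have D12 : 'D_dir1 ('D_dir2 (tquot 1 P)) (s, s) =
    tquot 2 (derive1 P) (s, s) - 2 * tquot 3 P (s, s).
  rewrite (near_eq_derive _ (near_of_open oU D2 Us)).
  have i1 := Dk_is_derive dir1 (Dk_tquot 0 1 oW sP1) Us.
  have i2 := Dk_is_derive dir1 (Dk_tquot 0 2 oW sP) Us.
  have [_ ->] := is_derive_sub i1 i2.
  by rewrite !D //= !mul0r !mul1r !addr0.
set y := derive1n 2 P s; set z := derive1n 3 P s.
rewrite (mixlogE (D _ _ _ _ sP Us) (D2 _ Us) D12) /=.
rewrite !mul0r addr0 !mul1r !tquot_diag -!derive1Sn -/y -/z.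
rewrite -[derive1n 1 P s]/(derive1 P s).
rewrite (_ : 2`! = 2)%N // (_ : 3`! = 6)%N // (_ : 1`! = 1)%N //.
by move: (derive1 P s) y z P0 => x y z x0; field.
Qed.

(** * Derivatives along an interval *)

(** Limits along [A] are unique because no point of a nondegenerate interval is
    isolated in it. *)
Lemma within_punctured_proper (R : realType) (A : set R) x :
  nondegenerate_interval A -> A x -> ProperFilter (within A x^').
Proof.
move=> [iA [a [b [Aa Ab ab]]]] Ax.
have [z Az zx] : exists2 z, A z & z != x.
  have [xa|xa] := eqVneq a x; last by exists a.
  by exists b => //; rewrite -xa gt_eqF.
apply: Build_ProperFilter_ex => B /nbhs_ballP [e e0 H].
have e20 : 0 < e / 2 by rewrite divr_gt0.
have [xz|zx'|xz] := ltgtP x z; last by rewrite xz eqxx in zx.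
- exists (Num.min z (x + e / 2)); apply: H.
  + rewrite /ball /= ltr_norml; apply/andP; split.
      have : Num.min z (x + e / 2) <= x + e / 2 by rewrite ge_min lexx orbT.
      by move=> ?; lra.
    have : x < Num.min z (x + e / 2) by rewrite lt_min xz ltrDl.
    by move=> ?; lra.
  + by rewrite /= gt_eqF // lt_min xz ltrDl.
  + apply: (iA x z) => //; rewrite ge_min lexx andbT ltW //.
    by rewrite lt_min xz ltrDl.
- exists (Num.max z (x - e / 2)); apply: H.
  + rewrite /ball /= ltr_norml; apply/andP; split.
      have : Num.max z (x - e / 2) < x by rewrite gt_max zx' gtrBl.
      by move=> ?; lra.
    have : x - e / 2 <= Num.max z (x - e / 2) by rewrite le_max lexx orbT.
    by move=> ?; lra.
  + by rewrite /= lt_eqF // gt_max zx' gtrBl.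
  + apply: (iA z x) => //; rewrite le_max lexx /= ltW //.
    by rewrite gt_max zx' gtrBl.
Qed.

Lemma derive_within_unique (R : realType) (A : set R) f x d :
  nondegenerate_interval A -> A x ->
  (f y - f x) / (y - x) @[y --> within A x^'] --> d ->
  derive_within A f x = d.
Proof.
move=> iA Ax H; have PF := within_punctured_proper iA Ax.
exact: cvg_lim H.
Qed.

(** At an end point of [A], the one-sided derivative is read off on a
    differentiable function defined on both sides. *)
Lemma is_derive_within (R : realType) (A : set R) f F x d :
  nondegenerate_interval A -> A x ->
  (\forall y \near within A (nbhs x), f y = F y) ->
  is_derive x 1 F d ->
  derivable_within A f x /\ derive_within A f x = d.
Proof.
move=> iA Ax fF [dF eF].
suff H : (f y - f x) / (y - x) @[y --> within A x^'] --> d.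
  by split; [apply/cvg_ex; exists d | exact: derive_within_unique].
have fFx : f x = F x by exact: (nbhs_singleton fF).
have cF : (fun h : R => h^-1 *: ((F \o shift x) (h *: (1 : R)) - F x)) @ 0^' --> d.
  by rewrite -eF.
apply/cvgrPdist_lt => e e0.
have /cvgrPdist_lt/(_ e e0)/nbhs_ballP [d1 d10 H1] := cF.
have /nbhs_ballP [d2 d20 H2] := fF.
have m0 : 0 < Num.min d1 d2 by rewrite lt_min d10 d20.
apply/nbhs_ballP; exists (Num.min d1 d2) => // y /= + yx Ay.
rewrite /ball /= lt_min => /andP [yd1 yd2].
have -> : f y = F y by apply: H2.
have := H1 (y - x); rewrite /ball /= sub0r opprB => /(_ yd1).
rewrite subr_eq0 => /(_ yx).
by rewrite -[_ *: 1]/(_ * _) mulr1 subrK fFx -[_ *: _]/(_ * _) mulrC.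
Qed.

Lemma is_derive_slice1 (R : realType) (F : R * R -> R) (u v d : R) :
  is_derive (u, v) dir1 F d -> is_derive u 1 (fun y => F (y, v)) d.
Proof.
move=> [dF eF].
have E : (fun h : R =>
    h^-1 *: (((fun y => F (y, v)) \o shift u) (h *: (1 : R)) - F (u, v))) =
  (fun h : R =>
    h^-1 *: ((F \o shift (u, v)) (h *: ((1, 0) : R * R)) - F (u, v))).
  apply/funext => h /=; congr (_ *: (F _ - _)).
  by congr pair; rewrite /= -[_ *: 0]/(_ * _) mulr0 add0r.
by split; [rewrite /derivable E | rewrite -eF /derive E].
Qed.

Lemma is_derive_slice2 (R : realType) (F : R * R -> R) (u v d : R) :
  is_derive (u, v) dir2 F d -> is_derive v 1 (fun y => F (u, y)) d.
Proof.
move=> [dF eF].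
have E : (fun h : R =>
    h^-1 *: (((fun y => F (u, y)) \o shift v) (h *: (1 : R)) - F (u, v))) =
  (fun h : R =>
    h^-1 *: ((F \o shift (u, v)) (h *: ((0, 1) : R * R)) - F (u, v))).
  apply/funext => h /=; congr (_ *: (F _ - _)).
  by congr pair; rewrite /= -[_ *: 0]/(_ * _) mulr0 add0r.
by split; [rewrite /derivable E | rewrite -eF /derive E].
Qed.

Lemma near_slice1 (R : realType) (A : set R) (u v : R) (B : set (R * R)) :
  A v -> (\forall q \near within (A `*` A) (nbhs (u, v)), B q) ->
  \forall y \near within A (nbhs u), B (y, v).
Proof.
move=> Av /nbhs_ballP [e e0 H].
apply/nbhs_ballP; exists e => // y yu Ay; apply: H => //.
by split => //=; exact: ballxx.
Qed.

Lemma near_slice2 (R : realType) (A : set R) (u v : R) (B : set (R * R)) :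
  A u -> (\forall q \near within (A `*` A) (nbhs (u, v)), B q) ->
  \forall y \near within A (nbhs v), B (u, y).
Proof.
move=> Au /nbhs_ballP [e e0 H].
apply/nbhs_ballP; exists e => // y yu Ay; apply: H => //.
by split => //=; exact: ballxx.
Qed.

Lemma is_partial1 (R : realType) (A : set R) (f F : R * R -> R) (u v d : R) :
  nondegenerate_interval A -> A u -> A v ->
  (\forall q \near within (A `*` A) (nbhs (u, v)), f q = F q) ->
  is_derive (u, v) dir1 F d ->
  has_partial1 A f (u, v) /\ partial1 A f (u, v) = d.
Proof.
move=> iA Au Av fF dF.
exact: (is_derive_within iA Au (near_slice1 Av fF) (is_derive_slice1 dF)).
Qed.

Lemma is_partial2 (R : realType) (A : set R) (f F : R * R -> R) (u v d : R) :
  nondegenerate_interval A -> A u -> A v ->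
  (\forall q \near within (A `*` A) (nbhs (u, v)), f q = F q) ->
  is_derive (u, v) dir2 F d ->
  has_partial2 A f (u, v) /\ partial2 A f (u, v) = d.
Proof.
move=> iA Au Av fF dF.
exact: (is_derive_within iA Av (near_slice2 Au fF) (is_derive_slice2 dF)).
Qed.

Lemma is_derive_ln_norm (R : realType) (z : R) :
  z != 0 -> is_derive z 1 (fun y : R => ln `|y|) z^-1.
Proof.
rewrite neq_lt => /orP[z0|z0].
  have Nz0 : 0 < - z by rewrite oppr_gt0.
  have H : \forall y \near z, ln (- y) = ln `|y| :> R.
    near=> y; rewrite ltr0_norm //; near: y; exact: lt_nbhsl.
  apply: (near_eq_is_derive H).
  have iN : is_derive z 1 (fun y : R => - y) (- 1) by exact: is_deriveN.
  have dN : differentiable (fun y : R => - y) z.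
    by apply/derivable1_diffP; case: iN.
  have [d e] := is_derive_comp1 (1 : R) (is_derive1_ln Nz0) dN.
  have [_ eN] := iN; rewrite eN in e.
  split; first exact: diff_derivable.
  by rewrite e mulrN1 invrN opprK.
have H : \forall y \near z, ln y = ln `|y| :> R.
  near=> y; rewrite gtr0_norm //; near: y; exact: lt_nbhsr.
exact: (near_eq_is_derive H (is_derive1_ln z0)).
Unshelve. all: by end_near. Qed.

Lemma is_derive_ln_norm_comp (R : realType) (V : normedModType R) (E : V -> R)
    x v d :
  E x != 0 -> differentiable E x -> is_derive x v E d ->
  is_derive x v (fun y => ln `|E y|) (d / E x).
Proof.
move=> E0 dE [_ <-].
have [d1 e] := is_derive_comp1 v (is_derive_ln_norm E0) dE.
by split; [exact: diff_derivable | rewrite mulrC -e].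
Qed.

(** * Jacobians vanishing on the diagonal *)

(** If the Jacobian determinant is [u - v] times a smooth nonvanishing factor,
    then the double pole comes from [ln `|u - v|] and the factor contributes the
    smooth remainder. *)
Lemma diagonal_remainder_factor (R : realType) (A : set R)
    (F : R * R -> R * R) t (U : set (R * R)) (K : R * R -> R) :
  nondegenerate_interval A -> open U -> U (t, t) ->
  (forall k, Dk k U K) -> (forall p, U p -> K p != 0) ->
  (forall u v, A u -> A v -> U (u, v) -> u != v ->
    has_jacobian A F (u, v) /\ Defs.jacobian A F (u, v) = (u - v) * K (u, v)) ->
  diagonal_remainder A F t (mixlog K).
Proof.
move=> iA oU Utt DK K0 HJ; exists U; split=> //.
  move=> a [_ Ua]; exists U, (mixlog K); split=> // k.
  by apply: Dk_Ck; exact: Dk_mixlog.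
pose dif (q : R * R) := q.1 - q.2.
pose U0 := U `&` [set q | dif q != 0].
have ddif q : differentiable dif q.
  exact: (differentiableB (differentiable_fst _) (differentiable_snd _)).
have idif q w : is_derive q w dif (w.1 - w.2).
  apply: is_derive_sub.
    by rewrite -(derive_fst q w); apply: derivableP; apply: diff_derivable;
      exact: differentiable_fst.
  by rewrite -(derive_snd q w); apply: derivableP; apply: diff_derivable;
    exact: differentiable_snd.
have oU0 : open U0.
  apply: openI => //; apply: (@open_comp _ _ dif [set x | x != 0]).
    by move=> q _; exact/differentiable_continuous.
  exact: open_neq.
pose G q := dif q * K q.
have G0 q : U0 q -> G q != 0 by move=> [Uq dq]; rewrite mulf_neq0 // K0.
have dG q : U0 q -> differentiable G q.
  by move=> [Uq _]; exact: (differentiableM (ddif q) (Dk_diff (DK 0) Uq)).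
pose L2 q := 'D_dir2 K q / K q - (dif q)^-1.
(* Definedness of the mixed derivative asks for the Jacobian at all nearby
   points, and those are again off the diagonal and in [U]. *)
have near0 q : U0 q -> A q.1 -> A q.2 ->
    \forall q' \near within (A `*` A) (nbhs q),
      [/\ U0 q', A q'.1, A q'.2 & (has_jacobian A F q' /\ Defs.jacobian A F q' = G q')].
  move=> Uq Aq1 Aq2; have N : nbhs q U0 by exact: open_nbhs_nbhs.
  apply: filterS N => -[a b] [Uab dab] [Aa Ab]; split=> //.
  by apply: HJ => //; rewrite -subr_eq0.
have H2 q : U0 q -> A q.1 -> A q.2 ->
    has_partial2 A (log_jacobian A F) q /\ partial2 A (log_jacobian A F) q = L2 q.
  case: q => a b Uq Aa Ab; have := near0 _ Uq Aa Ab => Nq.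
  have Nq' : \forall q \near within (A `*` A) (nbhs (a, b)),
      log_jacobian A F q = ln `|G q|.
    by apply: filterS Nq => q' [_ _ _ [_ J]]; rewrite /log_jacobian J.
  apply: (is_partial2 iA Aa Ab Nq').
  have iK := Dk_is_derive dir2 (DK 1) Uq.1.
  have iG := is_derive_mul (idif (a, b) dir2) iK.
  apply: (is_derive_eq (is_derive_ln_norm_comp (G0 _ Uq) (dG _ Uq) iG)).
  have K0' := K0 _ Uq.1; have d0 : dif (a, b) != 0 := Uq.2.
  rewrite /L2 /G /= sub0r.
  by move: ('D_dir2 K (a, b)) (K (a, b)) (dif (a, b)) K0' d0 => x y z y0 z0; field;
    rewrite y0 z0.
move=> u v Au Av Uuv uv.
have Up : U0 (u, v) by split=> //; rewrite /dif /= subr_eq0.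
have K0p := K0 _ Uuv; have d0 : dif (u, v) != 0 := Up.2.
have NL : \forall q \near within (A `*` A) (nbhs (u, v)),
    partial2 A (log_jacobian A F) q = L2 q.
  by apply: filterS (near0 _ Up Au Av) => q [Uq A1 A2 _]; exact: (H2 q Uq A1 A2).2.
have i2 := Dk_is_derive dir1 (Dk_derive dir2 (DK 2)) Uuv.
have i1 := Dk_is_derive dir1 (DK 1) Uuv.
have iL := is_derive_sub (is_derive_div K0p i2 i1)
  (is_derive_inv d0 (idif (u, v) dir1)).
have [hL eL] := is_partial1 iA Au Av NL iL.
split.
  split; last exact: hL.
  apply: filterS (near0 _ Up Au Av) => q [Uq A1 A2 [J1 J2]]; split=> //.
    by rewrite J2; exact: G0.
  exact: (H2 q Uq A1 A2).1.
rewrite /mixed_log_jacobian eL (mixlogE (K := K) erefl erefl erefl).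
have -> : dif (u, v) = - (v - u) by rewrite /dif /=; ring.
have vu : v - u != 0 by rewrite subr_eq0 eq_sym.
move: ('D_dir1 ('D_dir2 K) (u, v)) ('D_dir1 K (u, v)) ('D_dir2 K (u, v)).
move: (K (u, v)) K0p.
move=> k k0 k12 k1 k2 /=.
by move: (v - u) vu => z z0; field; rewrite k0 z0.
Qed.

(** Swapping the variables swaps the two partial derivatives. *)
Lemma Dk_swap (R : realType) k (W : set R) (f : R * R -> R) :
  open W -> Dk k [set p | W p.1 /\ W p.2] f ->
  Dk k [set p | W p.1 /\ W p.2] (fun p => f (p.2, p.1)).
Proof.
move=> oW; have oU := open_square oW; set U := [set p : R * R | _] in oU *.
have D g w p : Dk 0 U g -> U p -> differentiable (fun q => g (q.2, q.1)) p /\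
    'D_w (fun q => g (q.2, q.1)) p =
      w.2 * 'D_dir1 g (p.2, p.1) + w.1 * 'D_dir2 g (p.2, p.1).
  move=> Dg [W1 W2]; have dg : differentiable g (p.2, p.1).
    by apply: (Dk_diff Dg); split.
  have d1 := differentiable_snd p; have d2 := differentiable_fst p.
  have dgs : differentiable (fun q => g (q.2, q.1)) p.
    exact: (differentiable_comp (differentiable_pair d1 d2) dg).
  split=> //; rewrite (deriveE _ dgs) !(deriveE _ dg).
  apply: (diff_comp_pair dg d1 d2).
    by rewrite -(deriveE _ d1) derive_snd.
  by rewrite -(deriveE _ d2) derive_fst.
have D0 m g : Dk m U g -> Dk 0 U g by move=> Dg; split=> // p; exact: Dk_diff Dg.
elim: k f => [|k IH] f Df; split=> //.
- by move=> p Up; exact: (D f 0 p Df Up).1.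
- by move=> p Up; exact: (D f 0 p (D0 _ _ Df) Up).1.
- move=> w; have H := DkD oU (DkM oU (Dk_cst k U w.2) (IH _ (Df.2 dir1)))
    (DkM oU (Dk_cst k U w.1) (IH _ (Df.2 dir2))).
  apply: (Dk_eq oU _ H) => p Up.
  exact: esym (D f w p (D0 _ _ Df) Up).2.
Qed.

(** * The intersection map of the lines *)

Lemma tquot1E (R : realType) (f : R -> R) u v :
  f u - f v = (u - v) * tquot 1 f (u, v).
Proof.
by have := tquotS 0 f (u, v); rewrite tquot0 /= fact0 divr1 => ->; ring.
Qed.

Lemma tquot2E (R : realType) (f : R -> R) u v :
  (v - u) ^+ 2 * tquot 2 f (u, v) = f v - f u - derive1 f u * (v - u).
Proof.
have := tquotS 0 f (u, v); have := tquotS 1 f (u, v).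
rewrite tquot0 /= !divr1 => -> ->.
by rewrite /derive1n /=; ring.
Qed.

(** With [D u v] the second Taylor remainder of [h], the Jacobian of [Psi h] is
    [D u v * D v u / (u - v) ^ 3]. Both remainders contain [(u - v) ^ 2]; this is
    what is left after one factor [u - v] is taken out. *)
Definition Psi_factor (R : realType) (f : R -> R) (q : R * R) : R :=
  tquot 2 f q * tquot 2 f (q.2, q.1).

(** The same factor for the reparametrized map: the chain rule contributes
    [P' r * P' s], and [P r - P s] is [r - s] times the difference quotient of
    [P]. *)
Definition pullback_factor (R : realType) (f P : R -> R) (q : R * R) : R :=
  Psi_factor f (P q.1, P q.2) * (tquot 1 P q * (derive1 P q.1 * derive1 P q.2)).

Lemma Dk_Psi_factor (R : realType) (V : set R) k f :
  open V -> smooth1 V f -> Dk k [set p | V p.1 /\ V p.2] (Psi_factor f).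
Proof.
move=> oV sf; have D2 := Dk_tquot k 2 oV sf.
exact: (DkM (open_square oV) D2 (Dk_swap oV D2)).
Qed.

Lemma Dk_pullback_factor (R : realType) (V W : set R) k f P :
  open V -> open W -> smooth1 V f -> smooth1 W P -> (forall x, W x -> V (P x)) ->
  Dk k [set p | W p.1 /\ W p.2] (pullback_factor f P).
Proof.
move=> oV oW sf sP WV; have oU := open_square oW; have sP1 := smooth1_derive1 sP.
apply: DkM => //.
  apply: (Dk_prod_map oU sP _ _ (Dk_Psi_factor k oV sf)) => // x [W1 W2].
  by split; exact: WV.
apply: DkM => //; first exact: Dk_tquot.
apply: DkM => //.
  by apply: (Dk_comp1 oU sP1 _ (Dk_fst k oU)) => x [].
by apply: (Dk_comp1 oU sP1 _ (Dk_snd k oU)) => x [].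
Qed.

(** In terms of [g = f o P], the coordinates of the map are quotients with
    denominator [P r - P s]; the identity for the determinant is then algebra. *)
Lemma jacobian_Psi (R : realType) (A V W : set R) (h phi f P : R -> R) (r s : R) :
  nondegenerate_interval A -> A r -> A s -> open W -> W r -> W s ->
  smooth1 V f -> smooth1 W P -> (forall x, W x -> V (P x)) ->
  (forall x, A x -> W x -> phi x = P x) ->
  (forall x, A x -> W x -> h (phi x) = f (P x)) ->
  P r != P s ->
  let F p := Psi h (phi p.1, phi p.2) in
  has_jacobian A F (r, s) /\
  Defs.jacobian A F (r, s) = (r - s) * pullback_factor f P (r, s).
Proof.
move=> iA Ar As oW Wr Ws sf sP WV phiP hf Prs F.
pose g x := f (P x).
have ig x : W x -> is_derive x 1 g (derive1 f (P x) * derive1 P x).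
  move=> Wx; have iP := smooth1_is_derive sP Wx.
  have dP : differentiable P x by apply/derivable1_diffP; case: iP.
  have [d e] := is_derive_comp1 (1 : R) (smooth1_is_derive sf (WV _ Wx)) dP.
  by split; [exact: diff_derivable | rewrite e; case: iP => _ ->].
have iP x : W x -> is_derive x 1 P (derive1 P x) by exact: smooth1_is_derive.
pose den (q : R * R) := P q.1 - P q.2.
pose X (q : R * R) := (g q.2 - g q.1) / den q.
pose Y (q : R * R) := (P q.1 * g q.2 - P q.2 * g q.1) / den q.
have d0 : den (r, s) != 0 by rewrite /den /= subr_eq0.
have N : \forall q \near within (A `*` A) (nbhs (r, s)),
    (fst \o F) q = X q /\ (snd \o F) q = Y q.
  have N : nbhs ((r, s) : R * R) [set p | W p.1 /\ W p.2].
    by apply: open_nbhs_nbhs; split=> //; exact: open_square.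
  apply: filterS N => -[a b] [/= Wa Wb] [/= Aa Ab].
  by rewrite /F /= (hf a) // (hf b) // (phiP a) // (phiP b).
have NX : \forall q \near within (A `*` A) (nbhs (r, s)), (fst \o F) q = X q.
  by apply: filterS N => q [].
have NY : \forall q \near within (A `*` A) (nbhs (r, s)), (snd \o F) q = Y q.
  by apply: filterS N => q [].
have iP1 w := derive_comp_fst (p := (r, s)) w (iP r Wr).
have iP2 w := derive_comp_snd (p := (r, s)) w (iP s Ws).
have ig1 w := derive_comp_fst (p := (r, s)) w (ig r Wr).
have ig2 w := derive_comp_snd (p := (r, s)) w (ig s Ws).
have iden w := is_derive_sub (iP1 w) (iP2 w).
have iX w := is_derive_div d0 (is_derive_sub (ig2 w) (ig1 w)) (iden w).
have iY w := is_derive_div d0 (is_derive_sub (is_derive_mul (iP1 w) (ig2 w))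
  (is_derive_mul (iP2 w) (ig1 w))) (iden w).
have [hX1 eX1] := is_partial1 iA Ar As NX (iX dir1).
have [hX2 eX2] := is_partial2 iA Ar As NX (iX dir2).
have [hY1 eY1] := is_partial1 iA Ar As NY (iY dir1).
have [hY2 eY2] := is_partial2 iA Ar As NY (iY dir2).
split; first by split.
rewrite /Defs.jacobian eX1 eX2 eY1 eY2 /pullback_factor /Psi_factor.
have T1 := tquot1E P r s.
have T2 := tquot2E f (P r) (P s); have T3 := tquot2E f (P s) (P r).
rewrite /= /den /= /g in d0 *.
move: T1 T2 T3 d0.
move: (tquot 1 P (r, s)) (tquot 2 f _) (tquot 2 f _) (f (P r)) (f (P s)).
move: (derive1 f (P r)) (derive1 f (P s)) (derive1 P r) (derive1 P s).
move: (P r) (P s) => u v f1u f1v P1r P1s t1 t3 t2 fu fv T1 T2 T3 d0.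
have vu0 : v - u != 0 by rewrite -opprB oppr_eq0.

have -> : (r - s) * (t2 * t3 * (t1 * (P1r * P1s))) =
    (u - v) * (t2 * t3 * (P1r * P1s)) by rewrite T1; ring.
have -> : t2 = (fv - fu - f1u * (v - u)) / (v - u) ^+ 2.
  by rewrite -T2 [_ ^+ 2 * _]mulrC mulfK // expf_neq0.
have -> : t3 = (fu - fv - f1v * (u - v)) / (u - v) ^+ 2.
  by rewrite -T3 [_ ^+ 2 * _]mulrC mulfK // expf_neq0 // .
by field; rewrite d0 vu0.
Qed.

(** The remainder for the curve reparametrized by [phi]; the case [phi = id] is
    the original family of lines. *)
Lemma diagonal_remainder_Psi (R : realType) (A V W : set R)
    (h phi f P : R -> R) (t : R) :
  nondegenerate_interval A -> open V -> open W -> W t ->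
  smooth1 V f -> smooth1 W P -> (forall x, W x -> V (P x)) ->
  (forall x, A x -> W x -> phi x = P x) ->
  (forall x, A x -> W x -> h (phi x) = f (P x)) ->
  derive1 P t != 0 -> derive1n 2 f (P t) != 0 ->
  diagonal_remainder A (fun p => Psi h (phi p.1, phi p.2)) t
    (mixlog (pullback_factor f P)).
Proof.
move=> iA oV oW Wt sf sP WV phiP hf P0 f0.
pose B := [set p : R * R | W p.1 /\ W p.2].
have oB : open B by exact: open_square.
pose U := (B `&` [set q | pullback_factor f P q != 0])°.
have DB k := Dk_pullback_factor k oV oW sf sP WV.
have UB : U `<=` B `&` [set q | pullback_factor f P q != 0].
  exact: interior_subset.
have oU : open U by exact: open_interior.
have Utt : U (t, t).
  have Bt : B (t, t) by split.
  have K0 : pullback_factor f P (t, t) != 0.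
    rewrite /pullback_factor /Psi_factor !tquot_diag.
    rewrite !mulf_neq0 // ?invr_eq0 ?pnatr_eq0 -?lt0n ?fact_gt0 //.
  apply: filterI; first exact: open_nbhs_nbhs.
  have c := differentiable_continuous (Dk_diff (DB 0) Bt).
  apply: (c [set x | x != 0]); apply: open_nbhs_nbhs.
  by split=> //; exact: open_neq.
apply: (diagonal_remainder_factor iA oU Utt).
- by move=> k; apply: Dk_sub (DB k) => q /UB [].
- by move=> q /UB [].
move=> u v Au Av /UB [[/= Wu Wv] K0] uv.
apply: (jacobian_Psi iA Au Av oW Wu Wv sf sP WV phiP hf).
rewrite -subr_eq0 tquot1E mulf_neq0 ?subr_eq0 //.
by apply: contra_neq K0 => e; rewrite /pullback_factor e mul0r mulr0.
Qed.

(** * Uniqueness of the remainder and smooth extensions *)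

(** The factors of [pullback_factor] contribute separately: the factor of [Psi]
    by the chain rule, the difference quotient by the Schwarzian, and
    [P' r * P' s] nothing. *)
Lemma mixlog_pullback_diag (R : realType) (V W : set R) f P s :
  open V -> open W -> smooth1 V f -> smooth1 W P -> (forall x, W x -> V (P x)) ->
  W s -> derive1 P s != 0 -> derive1n 2 f (P s) != 0 ->
  mixlog (pullback_factor f P) (s, s) =
  mixlog (Psi_factor f) (P s, P s) * derive1 P s ^+ 2 +
  6^-1 * (derive1n 3 P s / derive1 P s -
          3 / 2 * (derive1n 2 P s / derive1 P s) ^+ 2).
Proof.
move=> oV oW sf sP WV Ws P0 f0; have sP1 := smooth1_derive1 sP.
have oU := open_square oW; set U := [set p : R * R | _] in oU.
have Us : U (s, s) by split.
have UV q : U q -> [set p : R * R | V p.1 /\ V p.2] (P q.1, P q.2).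
  by move=> [W1 W2]; split; exact: WV.
have DK := Dk_Psi_factor 2 oV sf.
have K0 : Psi_factor f (P s, P s) != 0.
  by rewrite /Psi_factor !tquot_diag !mulf_neq0 // invr_eq0 pnatr_eq0.
have T0 : tquot 1 P (s, s) != 0 by rewrite tquot_diag divr1.
have D1 := Dk_prod_map oU sP (fun x Ux => Ux) UV DK.
have D2 := Dk_tquot 2 1 oW sP.
have D3 := Dk_comp1 oU sP1 (fun q (Uq : U q) => Uq.1) (Dk_fst 2 oU).
have D4 := Dk_comp1 oU sP1 (fun q (Uq : U q) => Uq.2) (Dk_snd 2 oU).
have D34 := DkM oU D3 D4.
rewrite (mixlog_mul oU D1 (DkM oU D2 D34) Us K0); last by rewrite !mulf_neq0.
rewrite (mixlog_mul oU D2 D34 Us T0); last by rewrite mulf_neq0.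
rewrite (mixlog_mul oU D3 D4 Us P0 P0).
rewrite (mixlog_comp_fst oU (fun q (Uq : U q) => Uq.1) sP1 Us).
rewrite (mixlog_comp_snd oU (fun q (Uq : U q) => Uq.2) sP1 Us).
rewrite (mixlog_prod_map oU sP (fun x Ux => Ux) UV DK Us K0).
by rewrite (mixlog_tquot1_diag oW sP Ws P0) !addr0; congr (_ + _); rewrite -mulrA.
Qed.

Lemma tquot1_id (R : realType) (q : R * R) : tquot 1 id q = 1.
Proof.
case: q => u v; have [->|uv] := eqVneq u v.
  by rewrite tquot_diag divr1 [derive1n 1 id v]derive1_id.
have d0 : u - v != 0 by rewrite subr_eq0.
by apply: (mulfI d0); rewrite -tquot1E mulr1.
Qed.

Lemma pullback_factor_id (R : realType) (f : R -> R) :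
  pullback_factor f id = Psi_factor f.
Proof.
apply/funext => -[u v]; rewrite /pullback_factor tquot1_id.
by rewrite [derive1 id _]derive1_id [derive1 id _]derive1_id !mulr1.
Qed.

Lemma smooth_on_cvg (R : realType) (V : normedModType R) (A : set V) f a :
  smooth_on A f -> A a -> f x @[x --> within A (nbhs a)] --> f a.
Proof.
move=> sf Aa; have [U [F [oU Ua CF fF]]] := sf a Aa.
have [cF _] := CF 0; rewrite (fF a (mem_set (conj Aa Ua))).
have N : nbhs a U by exact: open_nbhs_nbhs.
move=> B /(cF a (mem_set Ua)) NB.
by apply: filterS2 N NB => x Ux Bx Ax /=; rewrite (fF x (mem_set (conj Ax Ux))).
Qed.

(** Off the diagonal two remainders agree since both are the given function minus
    the double pole; a point [(s, s)] is a limit of points [(r, s)], and both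
    remainders are continuous. *)
Lemma diagonal_remainder_unique (R : realType) (A : set R)
    (F : R * R -> R * R) t Q1 Q2 :
  nondegenerate_interval A ->
  diagonal_remainder A F t Q1 -> diagonal_remainder A F t Q2 ->
  \forall s \near within A (nbhs t), Q1 (s, s) = Q2 (s, s).
Proof.
move=> iA [U1 [oU1 U1t sQ1 H1]] [U2 [oU2 U2t sQ2 H2]].
have N : nbhs ((t, t) : R * R) (U1 `&` U2).
  by apply: open_nbhs_nbhs; split; [exact: openI | split].
have [e e0 HU] := (@nbhs_ballP _ _ _ _).1 N.
have : nbhs t (ball t e) by exact: nbhsx_ballx.
apply: filterS => s ts As.
have [U1s U2s] : (U1 `&` U2) (s, s) by apply: HU; split.
have PF := within_punctured_proper iA As.
have lim Q U : open U -> U (s, s) -> smooth_on ((A `*` A) `&` U) Q ->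
    Q (r, s) @[r --> within A s^'] --> Q (s, s).
  move=> oU Us sQ; apply: cvg_trans (smooth_on_cvg sQ _); last by split.
  move=> B /nbhs_ballP [d d0 HB].
  have /nbhs_ballP [d' d'0 HU'] : nbhs ((s, s) : R * R) U by exact: open_nbhs_nbhs.
  have m0 : 0 < Num.min d d' by rewrite lt_min d0 d'0.
  apply/nbhs_ballP; exists (Num.min d d') => // r.
  rewrite /ball /= lt_min => /andP[rd rd'] rs Ar.
  apply: HB; first by split=> //=; exact: ballxx.
  by split=> //; apply: HU'; split=> //=; exact: ballxx.
have E : \forall r \near within A s^', Q1 (r, s) = Q2 (r, s).
  have N2 : nbhs ((s, s) : R * R) (U1 `&` U2).
    by apply: open_nbhs_nbhs; split; [exact: openI | split].
  have /nbhs_ballP [d d0 HB] := N2.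
  apply/nbhs_ballP; exists d => // r rd rs Ar.
  have [U1r U2r] : (U1 `&` U2) (r, s) by apply: HB; split=> //=; exact: ballxx.
  have [_ E1] := H1 r s Ar As U1r rs; have [_ E2] := H2 r s Ar As U2r rs.
  by apply: (@addrI _ (1 / (s - r) ^+ 2)); rewrite -E1.
have L1 := lim _ _ oU1 U1s sQ1.
have L2 : Q1 (r, s) @[r --> within A s^'] --> Q2 (s, s).
  apply: cvg_trans (lim _ _ oU2 U2s sQ2); apply: near_eq_cvg.
  by apply: filterS E => r.
exact: (cvg_unique _ L1 L2).
Qed.

Lemma smooth_on_extension (R : realType) (A : set R) (f : R -> R) a :
  smooth_on A f -> A a -> exists (W : set R) (F : R -> R),
    [/\ open W, W a, smooth1 W F & forall x, A x -> W x -> f x = F x].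
Proof.
move=> sf Aa; have [U [F [oU Ua CF fF]]] := sf a Aa.
exists U, F; split=> //; first exact: Ck_smooth1.
by move=> x Ax Ux; exact: (fF x (mem_set (conj Ax Ux))).
Qed.

Lemma derive_within_extension (R : realType) (A W : set R) (f F : R -> R) x :
  nondegenerate_interval A -> open W -> smooth1 W F ->
  (forall y, A y -> W y -> f y = F y) -> A x -> W x ->
  derive_within A f x = derive1 F x.
Proof.
move=> iA oW sF fF Ax Wx; apply: (is_derive_within iA Ax _ _).2; last first.
  exact: smooth1_is_derive sF Wx.
have N : nbhs x W by exact: open_nbhs_nbhs.
by apply: filterS N => y Wy Ay; exact: fF.
Qed.

(** Differentiate [psi (phi x) = x] along [J], where [psi] is a local inverse. *)
Lemma local_diffeo_derive_neq0 (R : realType) (J W : set R) phi (P : R -> R) s :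
  nondegenerate_interval J -> local_diffeo J phi -> open W -> smooth1 W P ->
  (forall x, J x -> W x -> phi x = P x) -> J s -> W s -> derive1 P s != 0.
Proof.
move=> iJ dphi oW sP phiP Js Ws.
have [U [psi [oU Us _ spsi psiK]]] := dphi s Js.
have imgs x : J x -> U x -> (phi @` (J `&` U)) (phi x) by move=> ? ?; exists x.
have [V [Q [oV Vs sQ psiQ]]] := smooth_on_extension spsi (imgs _ Js Us).
have iP := smooth1_is_derive sP Ws.
have dP : differentiable P s by apply/derivable1_diffP; case: iP.
rewrite phiP // in Vs.
have [d e] := is_derive_comp1 (1 : R) (smooth1_is_derive sQ Vs) dP.
have iQP : is_derive s 1 (Q \o P) (derive1 Q (P s) * derive1 P s).
  by split; [exact: diff_derivable | rewrite e; case: iP => _ ->].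
have NV : nbhs s (P @^-1` V).
  apply: (differentiable_continuous dP); exact: open_nbhs_nbhs.
have N : \forall x \near within J (nbhs s), id x = (Q \o P) x.
  have NW : nbhs s W by exact: open_nbhs_nbhs.
  have NU : nbhs s U by exact: open_nbhs_nbhs.
  apply: filterS3 NV NW NU => x Vx Wx Ux Jx /=.
  rewrite -phiP // -psiQ ?phiP //; last by rewrite -phiP //; exact: imgs.
  by rewrite -phiP // (psiK x (mem_set (conj Jx Ux))).
have [_ e1] := is_derive_within iJ Js N iQP.
have NI : \forall x \near within J (nbhs s), id x = id x by exact: nearW.
have [_ e2] := is_derive_within iJ Js NI (is_derive_id s (1 : R)).
apply/eqP => P0; move: e1; rewrite e2 P0 mulr0 => /eqP.
by rewrite oner_eq0.
Qed.

Lemma schwarzianE (R : realType) (J W : set R) phi (P : R -> R) s :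
  nondegenerate_interval J -> open W -> smooth1 W P ->
  (forall x, J x -> W x -> phi x = P x) -> J s -> W s ->
  derive1 P s != 0 ->
  schwarzian J phi s = derive1n 3 P s / derive1 P s -
    3 / 2 * (derive1n 2 P s / derive1 P s) ^+ 2.
Proof.
move=> iJ oW sP phiP Js Ws P0.
have sP1 := smooth1_derive1 sP; have sP2 := smooth1_derive1 sP1.
have E1 x : J x -> W x -> derive_within J phi x = derive1 P x.
  exact: (derive_within_extension iJ oW sP phiP).
have E2 x : J x -> W x -> derive_within J (derive_within J phi) x = derive1n 2 P x.
  exact: (derive_within_extension iJ oW sP1 E1).
have iq := is_derive_div P0 (smooth1_is_derive sP2 Ws) (smooth1_is_derive sP1 Ws).
have N : \forall x \near within J (nbhs s),
    derive_within J (derive_within J phi) x / derive_within J phi x =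
    derive1n 2 P x / derive1 P x.
  have NW : nbhs s W by exact: open_nbhs_nbhs.
  by apply: filterS NW => x Wx Jx; rewrite (E1 x Jx Wx) (E2 x Jx Wx).
have [_ e] := is_derive_within iJ Js N iq.
rewrite /schwarzian e (E1 s Js Ws) (E2 s Js Ws).
rewrite -[derive1 (derive1 (derive1 P)) s]/(derive1n 3 P s).
rewrite -[derive1 (derive1 P) s]/(derive1n 2 P s).
by move: (derive1 P s) (derive1n 2 P s) (derive1n 3 P s) P0 => x y z x0; field.
Qed.

(** * Change of parameter *)

Lemma near_within_neq0 (R : realType) (A W : set R) (P g : R -> R) s :
  nbhs s W -> {for s, continuous P} -> {for P s, continuous g} ->
  g (P s) != 0 -> \forall x \near within A (nbhs s), W x /\ g (P x) != 0.
Proof.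
move=> NW cP cg gs0.
have N : nbhs (P s) [set y | g y != 0].
  apply: (cg [set z | z != 0]); apply: open_nbhs_nbhs.
  by split=> //; exact: open_neq.
have NP : nbhs s (P @^-1` [set y | g y != 0]) by exact: (cP _ N).
by apply: filterS2 NW NP => x Wx gx _.
Qed.

Theorem proposition6p1 (R : realType) (I J : set R) (h phi : R -> R) (s0 : R)
    (I_itv : nondegenerate_interval I) (J_itv : nondegenerate_interval J)
    (h_smooth : smooth_on I h)
    (phiJI : forall s, J s -> I (phi s))
    (phi_smooth : smooth_on J phi) (phi_diffeo : local_diffeo J phi)
    (s0J : J s0)
    (h2 : derive_within I (derive_within I h) (phi s0) != 0) :
  let Psit (p : R * R) := Psi h (phi p.1, phi p.2) in
  [/\ exists Rh, diagonal_remainder I (Psi h) (phi s0) Rh,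
      exists Rt, diagonal_remainder J Psit s0 Rt &
      forall Rh Rt : R * R -> R,
        diagonal_remainder I (Psi h) (phi s0) Rh ->
        diagonal_remainder J Psit s0 Rt ->
        \forall s \near within J (nbhs s0),
          Rt (s, s) = Rh (phi s, phi s) * derive_within J phi s ^+ 2
                      + 6^-1 * schwarzian J phi s].
Proof.
move=> Psit.
have [W0 [P [oW0 W0s sP0 phiP0]]] := smooth_on_extension phi_smooth s0J.
have [V [f [oV Vs sf hf]]] := smooth_on_extension h_smooth (phiJI _ s0J).
have Ps0 : phi s0 = P s0 by exact: phiP0.
have cP x : W0 x -> {for x, continuous P} := smooth1_continuous sP0.
(* Shrink the domain of [P] so that its values stay in the domain of [f]. *)
pose W := W0 `&` P @^-1` V.
have oW : open W.
  rewrite openE => x [W0x Vx]; apply: filterI; first exact: open_nbhs_nbhs.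
  by apply: (cP x W0x); exact: open_nbhs_nbhs.
have Ws : W s0 by split=> //; rewrite /preimage /= -Ps0.
have sP : smooth1 W P by apply: smooth1_sub sP0 => x [].
have WV x : W x -> V (P x) by case.
have phiP x : J x -> W x -> phi x = P x by move=> Jx [W0x _]; exact: phiP0.
have hfP x : J x -> W x -> h (phi x) = f (P x).
  by move=> Jx Wx; rewrite hf -?phiP //; [exact: phiJI | rewrite phiP //; exact: WV].
have P0 s : J s -> W s -> derive1 P s != 0.
  exact: (local_diffeo_derive_neq0 J_itv phi_diffeo oW sP phiP).
have If := phiJI _ s0J.
have E1 x : I x -> V x -> derive_within I h x = derive1 f x.
  exact: (derive_within_extension I_itv oV sf hf).
have f0 : derive1n 2 f (phi s0) != 0.
  by rewrite -[derive1n 2 f _](derive_within_extension I_itv oV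
    (smooth1_derive1 sf) E1).
have f0' : derive1n 2 f (P s0) != 0 by rewrite -Ps0.
have DRt : diagonal_remainder J Psit s0 (mixlog (pullback_factor f P)).
  exact: (diagonal_remainder_Psi J_itv oV oW Ws sf sP WV phiP hfP
    (P0 _ s0J Ws) f0').
(* The lines themselves are the case where the reparametrization is [id]. *)
have DRh : diagonal_remainder I (Psi h) (phi s0) (mixlog (Psi_factor f)).
  have sid : smooth1 V (@id R) by exact: smooth1_sub (@subsetT _ _) (@smooth1_id R).
  have id0 : derive1 (@id R) (phi s0) != 0 by rewrite derive1_id oner_neq0.
  have := diagonal_remainder_Psi I_itv oV oV Vs sf sid (fun x Vx => Vx)
    (fun x _ _ => erefl) hf id0 f0.
  by rewrite pullback_factor_id; congr diagonal_remainder; apply/funext => -[].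
split; [by exists (mixlog (Psi_factor f))|
        by exists (mixlog (pullback_factor f P))|].
move=> Rh Rt HRh HRt.
have Ut := diagonal_remainder_unique J_itv HRt DRt.
have Uh := diagonal_remainder_unique I_itv HRh DRh.
have Uh' : \forall s \near within J (nbhs s0),
    Rh (phi s, phi s) = mixlog (Psi_factor f) (phi s, phi s).
  have NW : nbhs s0 W by exact: open_nbhs_nbhs.
  rewrite Ps0 in Uh; have := cP s0 W0s _ Uh.
  apply: filterS2 NW => s Wss Hs Js.
  by rewrite phiP //; apply: Hs; rewrite -phiP //; exact: phiJI.
have Nf : \forall s \near within J (nbhs s0), W s /\ derive1n 2 f (P s) != 0.
  have NW : nbhs s0 W by exact: open_nbhs_nbhs.
  apply: (near_within_neq0 J NW (cP s0 W0s) _ f0').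
  by apply: (smooth1_continuous (smooth1_derive1n (n := 2) sf)); exact: WV.
near=> s.
have Js : J s by near: s; exact: withinT.
have [Wss fs] : W s /\ derive1n 2 f (P s) != 0 by near: s.
have -> : Rt (s, s) = mixlog (pullback_factor f P) (s, s) by near: s.
have -> : Rh (phi s, phi s) = mixlog (Psi_factor f) (phi s, phi s) by near: s.
rewrite (mixlog_pullback_diag oV oW sf sP WV Wss (P0 _ Js Wss) fs).
rewrite (schwarzianE J_itv oW sP phiP Js Wss (P0 _ Js Wss)).
by rewrite (derive_within_extension J_itv oW sP phiP Js Wss) (phiP _ Js Wss).
Unshelve. all: by end_near. Qed.
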